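(* Let $f(z) = z + a_2 z^2 + a_3 z^3 + \cdots$ belong to $\mathcal{S}_e^{\ast}$. Then $$|a_2a_3-a_4|\le\frac{8}{9\sqrt7}.$$ The inequality is sharp, i.e. equality holds for some function in $\mathcal{S}_e^{\ast}$.
   Context: $\mathbb{D}=\{z\in\mathbb{C}:|z|<1\}$. $\mathcal{S}$ is the class of univalent analytic functions $f$ on $\mathbb{D}$ with $f(0)=0$, $f'(0)=1$, written $f(z)=z+\sum_{n\ge2}a_nz^n$. For analytic $g,h$ on $\mathbb{D}$, $g\prec h$ (subordination) means that there is an analytic $\omega:\mathbb{D}\to\mathbb{D}$ with $\omega(0)=0$ and $g(z)=h(\omega(z))$ for $z\in\mathbb{D}$. The class $\mathcal{S}_e^{\ast}$ is $$\mathcal{S}_e^{\ast}=\left\{f\in\mathcal{S}:\ \frac{zf'(z)}{f(z)}\prec e^z,\ z\in\mathbb{D}\right\}.$$ *)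

(* Defs.v *)
From Stdlib Require Export Reals.
From Coquelicot Require Export Coquelicot.
Open Scope R_scope.

Definition disc (z : C) : Prop := Cmod z < 1.

(* Complex differentiability at every point.  Functions on the disc are
   represented by total functions [C -> C], of which only the values on the
   disc are relevant; the disc is open, so this also holds for [ex_derive]
   and [C_derive] at its points. *)
Definition analytic_on_disc (f : C -> C) : Prop :=
  forall z : C, disc z -> @ex_derive C_AbsRing C_NormedModule f z.

Definition univalent_on_disc (f : C -> C) : Prop :=
  forall z w : C, disc z -> disc w -> f z = f w -> z = w.

Definition class_S (f : C -> C) : Prop :=
  analytic_on_disc f /\ univalent_on_disc f /\
  f (RtoC 0) = RtoC 0 /\ C_derive f (RtoC 0) = RtoC 1.

Definition subordinate (g h : C -> C) : Prop :=
  exists omega : C -> C,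
    analytic_on_disc omega /\
    (forall z : C, disc z -> disc (omega z)) /\
    omega (RtoC 0) = RtoC 0 /\
    (forall z : C, disc z -> g z = h (omega z)).

Definition Cexp (z : C) : C :=
  (exp (Re z) * cos (Im z), exp (Re z) * sin (Im z)).

(* z f'(z) / f(z), with its removable singularity at 0 filled in by the limit
   value 1.  For [f] in [class_S] the denominator has no other zero in the
   disc. *)
Definition log_quotient (f : C -> C) (z : C) : C :=
  if Ceq_dec z (RtoC 0) then RtoC 1 else (z * C_derive f z / f z)%C.

Definition class_Se (f : C -> C) : Prop :=
  class_S f /\ subordinate (log_quotient f) Cexp.

(* f(z) = z + a_2 z^2 + a_3 z^3 + ... on the disc *)
Definition normalized_expansion (f : C -> C) (a : nat -> C) : Prop :=
  a 0%nat = RtoC 0 /\ a 1%nat = RtoC 1 /\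
  forall z : C, disc z -> @is_pseries C_AbsRing C_NormedModule a z (f z).

(* Main.v *)
From Stdlib Require Import Lra Lia ClassicalEpsilon.
Require Import Defs.

(** Why the theorem is true.  Write [z f' / f = exp w] with
    [w = c1 z + c2 z^2 + c3 z^3 + ...] mapping the disc into itself and fixing 0.
    Comparing coefficients gives [a_4 - a_2 a_3 = (c3 + c1 c2 - 5/6 c1^3) / 3], so
    the problem is one about bounded functions.  Schur's algorithm parametrizes
    the first coefficients: [c2 = (1 - |c1|^2) zeta] and
    [c3 = (1 - |c1|^2) (s - conj c1 zeta^2)] with [|s| <= 1 - |zeta|^2]
    ([schur_coefficients]).  The triangle inequality then leaves an elementary
    maximum in [|c1|] and [|zeta|] ([two_variable_maximum]), equal to
    [8 / (3 sqrt 7)].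

    The analytic core of the bound is the Schwarz lemma used in each step of the
    algorithm ([schwarz_punctured], [schur_step]).  It rests on a maximum principle
    with no integration: if [G] has a second-order expansion at [z], then the
    average of [|G|^2 + e |.|^2] over the four points [z + i^k t] exceeds, for small
    [t], its value at [z] ([no_interior_max]).  Such expansions are available because [f] is a
    power series: term-by-term differentiation ([sums_to_jet]) provides them for
    [f] and [f'], quotients preserve them, and so does the passage to the logarithm
    [w] of [z f' / f] ([log_smooth2]).  The division by [z] in the algorithm leaves
    a puncture at 0; applying the maximum principle to [z g^N] and letting [N]
    grow makes it harmless.

    For sharpness, the case of equality prescribes, up to rotation,
    [c1 = 2 / sqrt 7] and [zeta = -1], that is the Blaschke product [w = z (c - z) / (1 - c z)] with
    [c = 2 / sqrt 7].  The function is [f = z exp L] with [z L' = exp w - 1].  Its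
    power series converges in the disc because the exponential of a convergent
    power series solves a linear differential equation whose recursion preserves
    the radius of convergence ([tame_exp_coef], [Cexp_sums_to]).  It is univalent
    because it is starlike: in the variable [log z], which ranges over the convex
    left half-plane, [log f] has a derivative of positive real part
    ([starlike_univalent]). *)

Local Open Scope C_scope.

(** * Orders of vanishing at the origin *)

(** [P] holds at all small [h <> 0]: quotients by [h] are examined at the origin,
    where their values are meaningless. *)
Definition near (P : C -> Prop) : Prop :=
  exists d : R, (0 < d)%R /\ forall h : C, h <> RtoC 0 -> (Cmod h < d)%R -> P h.

Definition bigO (n : nat) (r : C -> C) : Prop :=
  exists K : R, (0 <= K)%R /\ near (fun h => (Cmod (r h) <= K * Cmod h ^ n)%R).

Lemma near_and (P Q : C -> Prop) : near P -> near Q -> near (fun h => P h /\ Q h).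
Proof.
  intros [d [Hd HP]] [e [He HQ]]. exists (Rmin d e); split.
  - now apply Rmin_glb_lt.
  - intros h h0 Hh; split; [apply HP | apply HQ]; auto;
    eapply Rlt_le_trans; eauto using Rmin_l, Rmin_r.
Qed.

Lemma near_imp (P Q : C -> Prop) :
  near P -> (forall h, h <> RtoC 0 -> P h -> Q h) -> near Q.
Proof. intros [d [Hd HP]] H. exists d; split; auto. Qed.

Lemma near_small (e : R) : (0 < e)%R -> near (fun h => (Cmod h < e)%R).
Proof. intros He. exists e; auto. Qed.

Lemma bigO_ext_near (n : nat) (r s : C -> C) :
  bigO n s -> near (fun h => r h = s h) -> bigO n r.
Proof.
  intros [K [HK H]] E. exists K; split; auto.
  apply near_imp with (1 := near_and _ _ H E). intros h _ [H1 ->]; auto.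
Qed.

Lemma bigO_ext (n : nat) (r s : C -> C) :
  bigO n s -> (forall h, h <> RtoC 0 -> r h = s h) -> bigO n r.
Proof.
  intros H E. apply bigO_ext_near with (1 := H). exists 1%R; split; [lra | auto].
Qed.

Lemma bigO_le (n m : nat) (r : C -> C) : (m <= n)%nat -> bigO n r -> bigO m r.
Proof.
  intros Hnm [K [HK H]]. exists K; split; auto.
  apply near_imp with (1 := near_and _ _ H (near_small 1 Rlt_0_1)).
  intros h _ [H1 H2]. eapply Rle_trans; [apply H1 |].
  apply Rmult_le_compat_l; auto.
  replace n with (m + (n - m))%nat by lia. rewrite pow_add.
  rewrite <- (Rmult_1_r (Cmod h ^ m)) at 2.
  apply Rmult_le_compat_l; [apply pow_le, Cmod_ge_0 |].
  rewrite <- (pow1 (n - m)). apply pow_incr. split; [apply Cmod_ge_0 | lra].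
Qed.

Lemma bigO_plus (n : nat) (r s : C -> C) :
  bigO n r -> bigO n s -> bigO n (fun h => r h + s h).
Proof.
  intros [K [HK H]] [L [HL H']]. exists (K + L)%R; split; [lra |].
  apply near_imp with (1 := near_and _ _ H H'). intros h _ [H1 H2].
  eapply Rle_trans; [apply Cmod_triangle | lra].
Qed.

Lemma bigO_mult (n m : nat) (r s : C -> C) :
  bigO n r -> bigO m s -> bigO (n + m) (fun h => r h * s h).
Proof.
  intros [K [HK H]] [L [HL H']]. exists (K * L)%R; split.
  { now apply Rmult_le_pos. }
  apply near_imp with (1 := near_and _ _ H H'). intros h _ [H1 H2].
  rewrite Cmod_mult, pow_add.
  replace (K * L * (Cmod h ^ n * Cmod h ^ m))%R
    with ((K * Cmod h ^ n) * (L * Cmod h ^ m))%R by ring.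
  apply Rmult_le_compat; auto using Cmod_ge_0.
Qed.

Lemma bigO_opp (n : nat) (r : C -> C) : bigO n r -> bigO n (fun h => - r h).
Proof.
  intros [K [HK H]]. exists K; split; auto.
  apply near_imp with (1 := H). intros h _. now rewrite Cmod_opp.
Qed.

Lemma bigO_minus (n : nat) (r s : C -> C) :
  bigO n r -> bigO n s -> bigO n (fun h => r h - s h).
Proof. intros Hr Hs. apply bigO_plus; auto. now apply bigO_opp. Qed.

Lemma bigO_const (c : C) : bigO 0 (fun _ => c).
Proof.
  exists (Cmod c); split; [apply Cmod_ge_0 |].
  exists 1%R; split; [lra |]. intros; simpl; lra.
Qed.

Lemma bigO_pow (n : nat) : bigO n (fun h => h ^ n).
Proof.
  exists 1%R; split; [lra |]. exists 1%R; split; [lra |].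
  intros; rewrite Cmod_pow; lra.
Qed.

Lemma bigO_id : bigO 1 (fun h => h).
Proof. apply bigO_ext with (1 := bigO_pow 1). intros; ring. Qed.

Lemma bigO_mult0 (n : nat) (r s : C -> C) :
  bigO n r -> bigO 0 s -> bigO n (fun h => r h * s h).
Proof. intros Hr Hs. rewrite <- (Nat.add_0_r n). now apply bigO_mult. Qed.

Lemma bigO_div (n : nat) (r : C -> C) : bigO (S n) r -> bigO n (fun h => r h / h).
Proof.
  intros [K [HK H]]. exists K; split; auto.
  apply near_imp with (1 := H). intros h h0 Hh.
  rewrite Cmod_div by auto. apply Cmod_gt_0 in h0.
  apply Rmult_le_reg_r with (Cmod h); auto. simpl in Hh.
  field_simplify; lra.
Qed.

Lemma bigO_near_le (r : C -> C) (e : R) :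
  (0 < e)%R -> bigO 1 r -> near (fun h => (Cmod (r h) < e)%R).
Proof.
  intros He [K [HK H]].
  assert (Hd : (0 < e / (K + 1))%R) by (apply Rdiv_lt_0_compat; lra).
  apply near_imp with (1 := near_and _ _ H (near_small _ Hd)).
  intros h _ [H1 H2]. eapply Rle_lt_trans; [apply H1 |].
  apply Rle_lt_trans with ((K + 1) * Cmod h)%R.
  - pose proof (Cmod_ge_0 h). simpl. nra.
  - apply Rmult_lt_compat_l with (r := (K + 1)%R) in H2; [| lra].
    field_simplify in H2; lra.
Qed.

Lemma Cmod_triangle_inv (x y : C) : (Cmod x - Cmod y <= Cmod (x - y))%R.
Proof.
  pose proof (Cmod_triangle (x - y) y) as H.
  replace (x - y + y) with x in H by ring. lra.
Qed.

Lemma Cmod_sub_sym (x y : C) : Cmod (x - y) = Cmod (y - x).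
Proof. rewrite <- Cmod_opp. f_equal. ring. Qed.

Lemma bigO_near_neq0 (c : C) (g : C -> C) :
  c <> RtoC 0 -> bigO 1 (fun h => g h - c) ->
  near (fun h => (Cmod c / 2 <= Cmod (g h))%R /\ g h <> RtoC 0).
Proof.
  intros Hc Hg. apply Cmod_gt_0 in Hc.
  apply near_imp with (1 := bigO_near_le _ (Cmod c / 2) ltac:(lra) Hg).
  intros h _ Hh. pose proof (Cmod_triangle_inv c (g h)) as T.
  rewrite Cmod_sub_sym in T. split; [lra |]. apply Cmod_gt_0; lra.
Qed.

Lemma bigO_inv (c : C) (g : C -> C) :
  c <> RtoC 0 -> bigO 1 (fun h => g h - c) -> bigO 0 (fun h => / g h).
Proof.
  intros Hc Hg. assert (Hc' := proj1 (Cmod_gt_0 _) Hc).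
  exists (2 / Cmod c)%R; split. { apply Rlt_le, Rdiv_lt_0_compat; lra. }
  apply near_imp with (1 := bigO_near_neq0 c g Hc Hg).
  intros h _ [H1 H2]. rewrite Cmod_inv by auto. simpl.
  rewrite Rmult_1_r. replace (2 / Cmod c)%R with (/ (Cmod c / 2))%R by (field; lra).
  apply Rinv_le_contravar; lra.
Qed.

(** Boundedness near the origin of functions assembled from functions of known
    order by ring operations. *)
Ltac bounded :=
  match goal with
  | H : bigO ?n ?r |- bigO 0 ?s => apply (bigO_le n 0); [lia | exact H]
  | |- bigO 0 (fun _ => ?c) => apply bigO_const
  | |- bigO ?n (Cmult ?a) => change (bigO n (fun h => a * h)); bounded
  | |- bigO ?n (Cplus ?a) => change (bigO n (fun h => a + h)); bounded
  | |- bigO 0 (fun h => _ + _) => apply bigO_plus; bounded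
  | |- bigO 0 (fun h => _ - _) => apply bigO_minus; bounded
  | |- bigO 0 (fun h => - _) => apply bigO_opp; bounded
  | |- bigO 0 (fun h => _ * _) => apply bigO_mult0; bounded
  | |- bigO 0 (fun h => h) => apply (bigO_le 1 0); [lia | apply bigO_id]
  | |- bigO 0 (fun h => h ^ ?n) => apply (bigO_le n 0); [lia | apply bigO_pow]
  end.

(** Reduces a sum to its terms, each of them a factor of the required order
    times a bounded function. *)
Ltac bigO_terms :=
  match goal with
  | H : bigO ?n ?r |- bigO ?n ?s => exact H
  | |- bigO _ (fun h => _ + _) => apply bigO_plus; bigO_terms
  | |- bigO _ (fun h => _ - _) => apply bigO_minus; bigO_terms
  | |- bigO ?n (fun h => h ^ ?n * _) => apply bigO_mult0; [apply bigO_pow | bounded]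
  | |- bigO _ (fun h => _ * _) => apply bigO_mult0; [bigO_terms | bounded]
  | |- bigO ?n (fun h => h ^ ?n) => apply bigO_pow
  | |- bigO ?n (Cmult ?a) => change (bigO n (fun h => a * h)); bigO_terms
  | |- bigO ?n (Cplus ?a) => change (bigO n (fun h => a + h)); bigO_terms
  end.

(** * Differentiability with a remainder estimate *)

(** Complex differentiability with a quadratic remainder: a form stable under
    products and composition with no appeal to continuity of derivatives. *)
Definition deriv_at (g : C -> C) (z d : C) : Prop :=
  bigO 2 (fun h => g (z + h) - g z - d * h).

(** A second-order Taylor expansion at [z]: what the maximum principle consumes,
    and what field operations and logarithms preserve. *)
Definition smooth2 (g : C -> C) (z : C) : Prop :=
  exists p q, bigO 3 (fun h => g (z + h) - (g z + p * h + q * h ^ 2)).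

Lemma smooth2_deriv_at (g : C -> C) (z : C) :
  smooth2 g z -> exists p, deriv_at g z p.
Proof.
  intros [p [q H]]. exists p. apply (bigO_le 3 2) in H; [| lia].
  apply bigO_ext with
    (s := fun h => (g (z + h) - (g z + p * h + q * h ^ 2)) + h ^ 2 * q).
  - bigO_terms.
  - intros; ring.
Qed.

Lemma deriv_at_bigO1 (g : C -> C) (z d : C) :
  deriv_at g z d -> bigO 1 (fun h => g (z + h) - g z).
Proof.
  intros H. apply (bigO_le 2 1) in H; [| lia].
  apply bigO_ext with (s := fun h => (g (z + h) - g z - d * h) + h ^ 1 * d).
  - bigO_terms.
  - intros; ring.
Qed.

Lemma smooth2_bigO1 (g : C -> C) (z : C) :
  smooth2 g z -> bigO 1 (fun h => g (z + h) - g z).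
Proof.
  intros H. destruct (smooth2_deriv_at _ _ H) as [p Hp].
  now apply (deriv_at_bigO1 g z p).
Qed.

Lemma smooth2_const (c z : C) : smooth2 (fun _ => c) z.
Proof.
  exists (RtoC 0), (RtoC 0). apply bigO_ext with (s := fun h => h ^ 3 * RtoC 0).
  - bigO_terms.
  - intros; ring.
Qed.

Lemma smooth2_id (z : C) : smooth2 (fun w => w) z.
Proof.
  exists (RtoC 1), (RtoC 0). apply bigO_ext with (s := fun h => h ^ 3 * RtoC 0).
  - bigO_terms.
  - intros; ring.
Qed.

Lemma smooth2_plus (f g : C -> C) (z : C) :
  smooth2 f z -> smooth2 g z -> smooth2 (fun w => f w + g w) z.
Proof.
  intros [p [q H]] [p' [q' H']]. exists (p + p'), (q + q').
  apply bigO_ext with (1 := bigO_plus _ _ _ H H'). intros; ring.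
Qed.

Lemma smooth2_mult (f g : C -> C) (z : C) :
  smooth2 f z -> smooth2 g z -> smooth2 (fun w => f w * g w) z.
Proof.
  intros [p [q H]] [p' [q' H']].
  exists (p * g z + f z * p'), (q * g z + p * p' + f z * q').
  apply bigO_ext with (s := fun h =>
    (f (z + h) - (f z + p * h + q * h ^ 2))
      * ((g (z + h) - (g z + p' * h + q' * h ^ 2)) + g z + p' * h + q' * h ^ 2)
    + (g (z + h) - (g z + p' * h + q' * h ^ 2)) * (f z + p * h + q * h ^ 2)
    + h ^ 3 * (p * q' + q * p' + q * q' * h)).
  - bigO_terms.
  - intros; ring.
Qed.

Lemma smooth2_scal (c : C) (g : C -> C) (z : C) :
  smooth2 g z -> smooth2 (fun w => c * g w) z.
Proof. intros H. apply smooth2_mult; auto using smooth2_const. Qed.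

Lemma smooth2_minus (f g : C -> C) (z : C) :
  smooth2 f z -> smooth2 g z -> smooth2 (fun w => f w - g w) z.
Proof.
  intros [p [q H]] [p' [q' H']]. exists (p - p'), (q - q').
  apply bigO_ext with (1 := bigO_minus _ _ _ H H'). intros; ring.
Qed.

Lemma smooth2_pow (g : C -> C) (z : C) (n : nat) :
  smooth2 g z -> smooth2 (fun w => g w ^ n) z.
Proof.
  intros H. induction n; simpl; auto using smooth2_const, smooth2_mult.
Qed.

Lemma smooth2_inv (g : C -> C) (z : C) :
  g z <> RtoC 0 -> smooth2 g z -> smooth2 (fun w => / g w) z.
Proof.
  intros g0 Hs. pose proof (smooth2_bigO1 _ _ Hs) as H1.
  pose proof (bigO_inv _ _ g0 H1) as Hi.
  pose proof (bigO_near_neq0 _ _ g0 H1) as Hn.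
  destruct Hs as [p [q H]]. set (a := g z) in *.
  set (p' := - p / a ^ 2). set (q' := p ^ 2 / a ^ 3 - q / a ^ 2).
  exists p', q'.
  (* 1/g - P = (1 - g P)/g, and the 2-jets of g and P multiply to 1 *)
  apply bigO_ext_near with (s := fun h =>
    (- (g (z + h) - (a + p * h + q * h ^ 2)) * (/ a + p' * h + q' * h ^ 2)
      - h ^ 3 * (p * q' + q * p' + q * q' * h)) * / g (z + h)).
  - apply bigO_mult0; [| exact Hi]. apply bigO_minus; [| bigO_terms].
    apply bigO_mult0; [now apply bigO_opp | bounded].
  - apply near_imp with (1 := Hn). intros h _ [_ Hg].
    change (g z) with a. unfold p', q'. field. auto.
Qed.

Lemma smooth2_div (f g : C -> C) (z : C) :
  g z <> RtoC 0 -> smooth2 f z -> smooth2 g z -> smooth2 (fun w => f w / g w) z.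
Proof. intros g0 Hf Hg. apply smooth2_mult; auto using smooth2_inv. Qed.

Lemma deriv_at_mult (f g : C -> C) (z d e : C) :
  deriv_at f z d -> deriv_at g z e ->
  deriv_at (fun w => f w * g w) z (d * g z + f z * e).
Proof.
  unfold deriv_at. intros H H'.
  apply bigO_ext with (s := fun h =>
    (f (z + h) - f z - d * h) * ((g (z + h) - g z - e * h) + g z + e * h)
    + (g (z + h) - g z - e * h) * (f z + d * h) + h ^ 2 * (d * e)).
  - bigO_terms.
  - intros; ring.
Qed.

Lemma deriv_at_plus (f g : C -> C) (z d e : C) :
  deriv_at f z d -> deriv_at g z e -> deriv_at (fun w => f w + g w) z (d + e).
Proof.
  intros H H'. apply bigO_ext with (1 := bigO_plus _ _ _ H H'). intros; ring.
Qed.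

Lemma deriv_at_id (z : C) : deriv_at (fun w => w) z (RtoC 1).
Proof.
  apply bigO_ext with (s := fun h => h ^ 2 * RtoC 0); [bigO_terms | intros; ring].
Qed.

Lemma deriv_at_opp (f : C -> C) (z d : C) :
  deriv_at f z d -> deriv_at (fun w => - f w) z (- d).
Proof. intros H. apply bigO_ext with (1 := bigO_opp _ _ H). intros; ring. Qed.

(** The chain rule.  The increment of [g] may vanish, where nothing is known
    about the remainder of [f]; there both sides are zero. *)
Lemma deriv_at_comp (f g : C -> C) (z d e : C) :
  deriv_at f (g z) d -> deriv_at g z e -> deriv_at (fun w => f (g w)) z (d * e).
Proof.
  intros Hf Hg. pose proof (deriv_at_bigO1 _ _ _ Hg) as H1.
  set (u := fun h => g (z + h) - g z) in *.
  assert (Hu : bigO 2 (fun h => f (g z + u h) - f (g z) - d * u h)).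
  { destruct Hf as [K [HK [r [Hr Hf]]]]. pose proof (bigO_near_le _ r Hr H1) as Hs.
    destruct H1 as [L [HL H1]].
    exists (K * L ^ 2)%R. split. { apply Rmult_le_pos; auto. apply pow2_ge_0. }
    apply near_imp with (1 := near_and _ _ H1 Hs). intros h _ [A B].
    assert (P : (0 <= Cmod h ^ 2)%R) by apply pow2_ge_0.
    destruct (Ceq_dec (u h) (RtoC 0)) as [Z | Z].
    - rewrite Z. replace (f (g z + RtoC 0) - f (g z) - d * RtoC 0) with (RtoC 0).
      + rewrite Cmod_0. apply Rmult_le_pos; auto. apply Rmult_le_pos; auto.
        apply pow2_ge_0.
      + replace (g z + RtoC 0) with (g z) by ring. ring.
    - eapply Rle_trans; [apply (Hf _ Z B) |].
      rewrite Rmult_assoc. apply Rmult_le_compat_l; auto.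
      rewrite <- Rpow_mult_distr. apply pow_incr. split; [apply Cmod_ge_0 |].
      simpl in A. lra. }
  apply bigO_ext with (s := fun h =>
    (f (g z + u h) - f (g z) - d * u h) + (g (z + h) - g z - e * h) * d).
  - unfold deriv_at in Hg. bigO_terms.
  - intros h _. unfold u. replace (g z + (g (z + h) - g z)) with (g (z + h)) by ring.
    ring.
Qed.

Lemma ball_Cmod (z w : C) (e : posreal) :
  @ball C_UniformSpace z e w -> (Cmod (w - z) < 2 * e)%R.
Proof.
  intros H. apply C_NormedModule_mixin_compat2 in H.
  eapply Rlt_le_trans; [apply H |]. apply Rmult_le_compat_r; [apply Rlt_le, cond_pos |].
  pose proof (sqrt_sqrt 2 ltac:(lra)). pose proof (sqrt_pos 2). nra.
Qed.

Lemma deriv_at_is_derive (f : C -> C) (z d : C) :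
  deriv_at f z d -> @is_derive C_AbsRing C_NormedModule f z d.
Proof.
  intros [K [HK [r [Hr H]]]]. split.
  - apply is_linear_scal_l.
  - intros x Hx.
    apply (@is_filter_lim_locally_unique C_AbsRing (AbsRing_NormedModule C_AbsRing)) in Hx.
    subst x. intros eps.
    assert (Hd : (0 < Rmin r (eps / (K + 1)))%R).
    { apply Rmin_glb_lt; auto. apply Rdiv_lt_0_compat; [apply cond_pos | lra]. }
    exists (mkposreal _ Hd). intros y Hy.
    change (Cmod (y - z) < Rmin r (eps / (K + 1)))%R in Hy.
    change (Cmod (f y - f z - (y - z) * d) <= eps * Cmod (y - z))%R.
    set (h := y - z) in *.
    replace y with (z + h) by (unfold h; ring).
    destruct (Ceq_dec h (RtoC 0)) as [Z | Z].
    { rewrite Z. replace (z + RtoC 0) with z by ring.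
      replace (f z - f z - RtoC 0 * d) with (RtoC 0) by ring.
      rewrite Cmod_0. lra. }
    assert (B1 : (Cmod h < r)%R) by (pose proof (Rmin_l r (eps / (K + 1))); lra).
    assert (B2 : (Cmod h < eps / (K + 1))%R)
      by (pose proof (Rmin_r r (eps / (K + 1))); lra).
    specialize (H h Z B1).
    replace (f (z + h) - f z - h * d) with (f (z + h) - f z - d * h) by ring.
    eapply Rle_trans; [apply H |].
    apply Rmult_lt_compat_l with (r := (K + 1)%R) in B2; [| lra].
    replace ((K + 1) * (eps / (K + 1)))%R with (pos eps) in B2 by (field; lra).
    pose proof (Cmod_ge_0 h). simpl. nra.
Qed.

Lemma ex_derive_continuous_near (f : C -> C) (z : C) (e : R) :
  (0 < e)%R -> @ex_derive C_AbsRing C_NormedModule f z ->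
  near (fun h => (Cmod (f (z + h)%C - f z) < e)%R).
Proof.
  intros He H. apply (ex_derive_continuous f) in H.
  assert (He2 : (0 < e / 2)%R) by lra.
  specialize (H _ (locally_ball (f z) (mkposreal _ He2))).
  destruct H as [d Hd]. exists d. split; [apply cond_pos |].
  intros h _ Hh. specialize (Hd (z + h)).
  assert (B : (Cmod (z + h - z) < d)%R).
  { replace (z + h - z) with h by ring. auto. }
  apply Hd, ball_Cmod in B. simpl in B. lra.
Qed.

(** * The exponential near the origin, and its inverse *)

(** Integrating a remainder estimate raises its order by one; iterated from crude
    bounds, this gives the Taylor estimates of [exp], [cos] and [sin]. *)
Lemma mvt_power_bound (r r' : R -> R) (n : nat) (K : R) :
  (forall x, is_derive r x (r' x)) -> r 0%R = 0%R -> (0 <= K)%R ->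
  (forall x, Rabs x <= 1 -> Rabs (r' x) <= K * Rabs x ^ n)%R ->
  forall x, (Rabs x <= 1 -> Rabs (r x) <= K * Rabs x ^ (S n))%R.
Proof.
  intros Hd H0 HK Hb x Hx.
  destruct (MVT_gen r 0 x r') as [c [Hc E]].
  - intros; apply Hd.
  - intros y _. apply continuity_pt_filterlim, (ex_derive_continuous r).
    exists (r' y); apply Hd.
  - rewrite H0 in E. replace (r x) with (r' c * x)%R by lra.
    assert (Hcx : (Rabs c <= Rabs x)%R).
    { revert Hc. unfold Rmin, Rmax, Rabs. repeat destruct Rle_dec;
      repeat destruct Rcase_abs; lra. }
    rewrite Rabs_mult. simpl.
    replace (K * (Rabs x * Rabs x ^ n))%R with ((K * Rabs x ^ n) * Rabs x)%R by ring.
    apply Rmult_le_compat_r; [apply Rabs_pos |].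
    eapply Rle_trans; [apply Hb; lra |].
    apply Rmult_le_compat_l; auto. apply pow_incr. split; [apply Rabs_pos | auto].
Qed.

Lemma exp_taylor3 (x : R) : (Rabs x <= 1 ->
  Rabs (exp x - (1 + x + x ^ 2 / 2 + x ^ 3 / 6)) <= 3 * Rabs x ^ 4)%R.
Proof.
  revert x.
  apply (mvt_power_bound (fun x => exp x - (1 + x + x ^ 2 / 2 + x ^ 3 / 6))%R
    (fun x => exp x - (1 + x + x ^ 2 / 2))%R);
    [intros x; auto_derive; auto; field | rewrite exp_0; field | lra |].
  apply (mvt_power_bound (fun x => exp x - (1 + x + x ^ 2 / 2))%R
    (fun x => exp x - (1 + x))%R);
    [intros x; auto_derive; auto; field | rewrite exp_0; field | lra |].
  apply (mvt_power_bound (fun x => exp x - (1 + x))%R (fun x => exp x - 1)%R);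
    [intros x; auto_derive; auto; ring | rewrite exp_0; ring | lra |].
  apply (mvt_power_bound (fun x => exp x - 1)%R exp);
    [intros x; auto_derive; auto; ring | rewrite exp_0; ring | lra |].
  intros x Hx. rewrite Rabs_pos_eq by (left; apply exp_pos). simpl.
  apply Rle_trans with (exp 1); [| pose proof exp_le_3; lra].
  destruct (Rle_lt_or_eq_dec x 1) as [H | ->]; [| left; now apply exp_increasing | lra].
  revert Hx; unfold Rabs; destruct Rcase_abs; lra.
Qed.

Lemma cos_sin_taylor3 (x : R) : (Rabs x <= 1 ->
  Rabs (cos x - (1 - x ^ 2 / 2)) <= 1 * Rabs x ^ 4 /\
  Rabs (sin x - (x - x ^ 3 / 6)) <= 1 * Rabs x ^ 5)%R.
Proof.
  assert (S1 : forall x, (Rabs x <= 1 -> Rabs (sin x) <= 1 * Rabs x ^ 1)%R).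
  { apply (mvt_power_bound sin cos);
    [intros y; auto_derive; auto; ring | apply sin_0 | lra |].
    intros y _. simpl. rewrite Rmult_1_r. apply Rabs_le, COS_bound. }
  assert (C2 : forall x, (Rabs x <= 1 -> Rabs (cos x - 1) <= 1 * Rabs x ^ 2)%R).
  { apply (mvt_power_bound (fun x => cos x - 1)%R (fun x => - sin x)%R);
    [intros y; auto_derive; auto; ring | rewrite cos_0; ring | lra |].
    intros y Hy. rewrite Rabs_Ropp. auto. }
  assert (S3 : forall x, (Rabs x <= 1 -> Rabs (sin x - x) <= 1 * Rabs x ^ 3)%R).
  { apply (mvt_power_bound (fun x => sin x - x)%R (fun x => cos x - 1)%R); auto;
    [intros y; auto_derive; auto; ring | rewrite sin_0; ring | lra]. }
  assert (C4 : forall x, (Rabs x <= 1 ->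
    Rabs (cos x - (1 - x ^ 2 / 2)) <= 1 * Rabs x ^ 4)%R).
  { apply (mvt_power_bound (fun x => cos x - (1 - x ^ 2 / 2))%R
      (fun x => - (sin x - x))%R);
    [intros y; auto_derive; auto; field | rewrite cos_0; field | lra |].
    intros y Hy. rewrite Rabs_Ropp. auto. }
  intros Hx. split; [now apply C4 | revert x Hx].
  apply (mvt_power_bound (fun x => sin x - (x - x ^ 3 / 6))%R
    (fun x => cos x - (1 - x ^ 2 / 2))%R); auto;
    [intros y; auto_derive; auto; field | rewrite sin_0; field | lra].
Qed.

Lemma Cmod_le_Rabs (w : C) : (Cmod w <= Rabs (fst w) + Rabs (snd w))%R.
Proof.
  apply Rsqr_incr_0_var.
  - unfold Rsqr. replace (Cmod w * Cmod w)%R with (Cmod w ^ 2)%R by ring.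
    rewrite Cmod2_alt. unfold Re, Im.
    rewrite <- (pow2_abs (fst w)), <- (pow2_abs (snd w)).
    pose proof (Rabs_pos (fst w)). pose proof (Rabs_pos (snd w)). nra.
  - pose proof (Rabs_pos (fst w)). pose proof (Rabs_pos (snd w)). lra.
Qed.

Lemma Rabs_mult_le (x y a b : R) :
  (Rabs x <= a -> Rabs y <= b -> Rabs (x * y) <= a * b)%R.
Proof.
  intros. rewrite Rabs_mult. apply Rmult_le_compat; auto using Rabs_pos.
Qed.

(** The products of the real Taylor polynomials agree with the complex one up to
    terms of degree at least 4, because [Cexp] is multiplicative. *)
Lemma Cexp_taylor3 (w : C) : (Cmod w <= 1)%R ->
  (Cmod (Cexp w - (1 + w + w ^ 2 / 2 + w ^ 3 / 6)) <= 25 * Cmod w ^ 4)%R.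
Proof.
  intros Hw. destruct w as [x y]. set (m := Cmod (x, y)) in *.
  assert (Hx : (Rabs x <= m)%R).
  { eapply Rle_trans; [| apply Rmax_Cmod]. apply Rmax_l. }
  assert (Hy : (Rabs y <= m)%R).
  { eapply Rle_trans; [| apply Rmax_Cmod]. apply Rmax_r. }
  assert (Hm : (0 <= m)%R) by apply Cmod_ge_0.
  pose proof (exp_taylor3 x ltac:(lra)) as He.
  destruct (cos_sin_taylor3 y ltac:(lra)) as [Hc Hs].
  set (E := (1 + x + x ^ 2 / 2 + x ^ 3 / 6)%R) in *.
  set (Co := (1 - y ^ 2 / 2)%R) in *. set (Si := (y - y ^ 3 / 6)%R) in *.
  assert (P4 : forall t, (Rabs t <= m -> Rabs t ^ 4 <= m ^ 4)%R).
  { intros; apply pow_incr; split; auto using Rabs_pos. }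
  assert (M4 : (0 <= m ^ 4)%R) by now apply pow_le.
  assert (He' : (Rabs (exp x - E) <= 3 * m ^ 4)%R) by (specialize (P4 x Hx); lra).
  assert (Hc' : (Rabs (cos y - Co) <= m ^ 4)%R) by (specialize (P4 y Hy); lra).
  assert (Hs' : (Rabs (sin y - Si) <= m ^ 4)%R).
  { specialize (P4 y Hy). pose proof (Rabs_pos y).
    assert (0 <= Rabs y ^ 4)%R by now apply pow_le.
    simpl in *. nra. }
  assert (X : (-m <= x <= m)%R) by now apply Rabs_le_between.
  assert (Y : (-m <= y <= m)%R) by now apply Rabs_le_between.
  assert (EB : (Rabs (exp x) <= 3)%R).
  { rewrite Rabs_pos_eq by (left; apply exp_pos).
    apply Rle_trans with (exp 1); [| apply exp_le_3].
    destruct (Req_dec x 1) as [-> | N]; [lra | left; apply exp_increasing; lra]. }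
  assert (CB : (Rabs Co <= 1)%R) by (apply Rabs_le; unfold Co; nra).
  assert (SB : (Rabs Si <= 2)%R) by (apply Rabs_le; unfold Si; split; nra).
  assert (X2 : (Rabs (x * x) <= m * m)%R) by now apply Rabs_mult_le.
  assert (Y2 : (Rabs (y * y) <= m * m)%R) by now apply Rabs_mult_le.
  assert (XY : (Rabs (x * y) <= m * m)%R) by now apply Rabs_mult_le.
  assert (Q1 : (Rabs ((x * x) * (y * y)) <= m ^ 4)%R).
  { replace (m ^ 4)%R with ((m * m) * (m * m))%R by ring. now apply Rabs_mult_le. }
  assert (Q2 : (Rabs ((x * x) * (x * y)) <= m ^ 4)%R).
  { replace (m ^ 4)%R with ((m * m) * (m * m))%R by ring. now apply Rabs_mult_le. }
  assert (Q3 : (Rabs ((x * y) * (y * y)) <= m ^ 4)%R).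
  { replace (m ^ 4)%R with ((m * m) * (m * m))%R by ring. now apply Rabs_mult_le. }
  assert (A1 : (Rabs (- / 4 - x / 12) <= 1)%R) by (apply Rabs_le; lra).
  assert (A2 : (Rabs (y * - / 12 - x * y / 36) <= 1)%R) by (apply Rabs_le; nra).
  assert (Re4 : (Rabs (exp x * cos y - (1 + x + (x ^ 2 - y ^ 2) / 2
                 + (x ^ 3 - 3 * x * y ^ 2) / 6)) <= 12 * m ^ 4)%R).
  { replace (exp x * cos y - (1 + x + (x ^ 2 - y ^ 2) / 2
                 + (x ^ 3 - 3 * x * y ^ 2) / 6))%R
      with (exp x * (cos y - Co) + (exp x - E) * Co
            + ((x * x) * (y * y)) * (- / 4 - x / 12))%R by (unfold E, Co; field).
    pose proof (Rabs_mult_le _ _ _ _ EB Hc').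
    pose proof (Rabs_mult_le _ _ _ _ He' CB).
    pose proof (Rabs_mult_le _ _ _ _ Q1 A1).
    eapply Rle_trans; [apply Rabs_triang |].
    eapply Rle_trans; [apply Rplus_le_compat_r, Rabs_triang | lra]. }
  assert (Im4 : (Rabs (exp x * sin y - (y + x * y + (3 * x ^ 2 * y - y ^ 3) / 6))
                 <= 12 * m ^ 4)%R).
  { replace (exp x * sin y - (y + x * y + (3 * x ^ 2 * y - y ^ 3) / 6))%R
      with (exp x * (sin y - Si) + (exp x - E) * Si
            + ((x * x) * (x * y)) * / 6 - ((x * y) * (y * y)) * / 6
            + ((x * x) * (y * y)) * (y * - / 12 - x * y / 36))%R
      by (unfold E, Si; field).
    pose proof (Rabs_mult_le _ _ _ _ EB Hs').
    pose proof (Rabs_mult_le _ _ _ _ He' SB).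
    pose proof (Rabs_mult_le _ _ _ _ Q1 A2).
    pose proof (Rabs_mult_le _ (/ 6) _ 1 Q2 ltac:(rewrite Rabs_pos_eq; lra)).
    pose proof (Rabs_mult_le _ (/ 6) _ 1 Q3 ltac:(rewrite Rabs_pos_eq; lra)).
    eapply Rle_trans; [apply Rabs_triang |].
    eapply Rle_trans; [apply Rplus_le_compat_r, Rabs_triang |].
    rewrite Rabs_Ropp.
    eapply Rle_trans; [apply Rplus_le_compat_r, Rplus_le_compat_r, Rabs_triang |].
    eapply Rle_trans;
      [apply Rplus_le_compat_r, Rplus_le_compat_r, Rplus_le_compat_r, Rabs_triang | lra]. }
  assert (Eq : Cexp (x, y) - (1 + (x, y) + (x, y) ^ 2 / 2 + (x, y) ^ 3 / 6) =
    ((exp x * cos y - (1 + x + (x ^ 2 - y ^ 2) / 2 + (x ^ 3 - 3 * x * y ^ 2) / 6))%R,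
     (exp x * sin y - (y + x * y + (3 * x ^ 2 * y - y ^ 3) / 6))%R)).
  { unfold Cexp, Cminus, Cplus, Copp, Cdiv, Cmult, Cinv, Cpow, Cmult, RtoC, Re, Im; simpl.
    f_equal; field. }
  rewrite Eq. eapply Rle_trans; [apply Cmod_le_Rabs |]. cbn [fst snd]. fold m. lra.
Qed.

Lemma Cexp_plus (z w : C) : Cexp (z + w) = Cexp z * Cexp w.
Proof.
  destruct z as [a b], w as [c d]. unfold Cexp, Cmult; simpl.
  rewrite exp_plus, cos_plus, sin_plus. f_equal; ring.
Qed.

Lemma Cexp_0 : Cexp (RtoC 0) = RtoC 1.
Proof.
  unfold Cexp, RtoC; simpl. rewrite exp_0, cos_0, sin_0. f_equal; ring.
Qed.

Lemma Cexp_opp_r (z : C) : Cexp z * Cexp (- z) = RtoC 1.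
Proof. rewrite <- Cexp_plus. replace (z + - z) with (RtoC 0) by ring. apply Cexp_0. Qed.

Lemma Cexp_neq0 (z : C) : Cexp z <> RtoC 0.
Proof.
  intros E. pose proof (Cexp_opp_r z) as H. rewrite E, Cmult_0_l in H.
  apply C1_nz. auto.
Qed.

Lemma deriv_at_Cexp (z : C) : deriv_at Cexp z (Cexp z).
Proof.
  assert (H : bigO 4 (fun h => Cexp h - (1 + h + h ^ 2 / 2 + h ^ 3 / 6))).
  { exists 25%R; split; [lra |]. exists 1%R; split; [lra |].
    intros h _ Hh. apply Cexp_taylor3. lra. }
  apply (bigO_le 4 2) in H; [| lia].
  apply bigO_ext with (s := fun h =>
    (Cexp h - (1 + h + h ^ 2 / 2 + h ^ 3 / 6)) * Cexp z
    + h ^ 2 * (Cexp z / 2 + h * (Cexp z / 6))).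
  - bigO_terms.
  - intros h _. rewrite Cexp_plus. field.
Qed.

(** A small logarithm is determined by its exponential: inverting the Taylor
    polynomial of [Cexp] gives that of the logarithm. *)
Lemma bigO_log (G d : C -> C) :
  (forall e : R, (0 < e)%R -> near (fun h => (Cmod (d h) < e)%R)) ->
  bigO 1 G -> near (fun h => Cexp (d h) - 1 = G h) ->
  bigO 4 (fun h => d h - (G h - G h ^ 2 / 2 + G h ^ 3 / 3)).
Proof.
  intros Hd HG Hn.
  (* d is of the order of exp d - 1, since higher terms are absorbed for |d| < 1/100 *)
  assert (D1 : bigO 1 d).
  { destruct HG as [K [HK HG]]. exists (2 * K)%R; split; [lra |].
    apply near_imp with
      (1 := near_and _ _ (near_and _ _ HG Hn) (Hd (/ 100)%R ltac:(lra))).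
    intros h _ [[A B] Hs]. rewrite <- B in A.
    pose proof (Cexp_taylor3 (d h) ltac:(lra)) as T.
    set (w := d h) in *. pose proof (Cmod_ge_0 w) as Pw.
    assert (T2 : (Cmod (w ^ 2 / 2 + w ^ 3 / 6) <= Cmod w / 4)%R).
    { replace (w ^ 2 / 2 + w ^ 3 / 6) with (w * (w * (RtoC (/ 2)) + w * w * RtoC (/ 6))).
      2:{ rewrite !RtoC_inv by lra. field. }
      rewrite Cmod_mult. apply Rmult_le_compat_l; auto.
      eapply Rle_trans; [apply Cmod_triangle |]. rewrite !Cmod_mult, !Cmod_R.
      rewrite !Rabs_pos_eq by lra. nra. }
    assert (T3 : (25 * Cmod w ^ 4 <= Cmod w / 4)%R).
    { replace (25 * Cmod w ^ 4)%R with (Cmod w * (25 * Cmod w ^ 3))%R by ring.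
      apply Rmult_le_compat_l; auto. simpl. rewrite Rmult_1_r.
      assert (Cmod w * Cmod w <= / 100 * 1)%R by (apply Rmult_le_compat; lra).
      assert (Cmod w * (Cmod w * Cmod w) <= / 100 * 1)%R
        by (apply Rmult_le_compat; try lra; apply Rmult_le_pos; lra). lra. }
    assert (W : w = (Cexp w - 1) - (Cexp w - (1 + w + w ^ 2 / 2 + w ^ 3 / 6))
                    - (w ^ 2 / 2 + w ^ 3 / 6)) by ring.
    assert (Cmod w <= Cmod (Cexp w - 1) + 25 * Cmod w ^ 4 + Cmod w / 4)%R.
    { rewrite W at 1. eapply Rle_trans; [apply Cmod_triangle |].
      rewrite Cmod_opp. apply Rplus_le_compat; auto.
      eapply Rle_trans; [apply Cmod_triangle |]. rewrite Cmod_opp. lra. }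
    lra. }
  set (r := fun h => Cexp (d h) - (1 + d h + d h ^ 2 / 2 + d h ^ 3 / 6)).
  assert (R4 : bigO 4 r).
  { pose proof (Hd 1%R ltac:(lra)) as Hs. destruct D1 as [K [HK D1]].
    exists (25 * K ^ 4)%R; split.
    { apply Rmult_le_pos; [lra | now apply pow_le]. }
    apply near_imp with (1 := near_and _ _ D1 Hs). intros h _ [A B].
    eapply Rle_trans; [apply Cexp_taylor3; lra |].
    rewrite Rmult_assoc, <- Rpow_mult_distr. apply Rmult_le_compat_l; [lra |].
    apply pow_incr. split; [apply Cmod_ge_0 | simpl in A; lra]. }
  assert (D4 : bigO 4 (fun h => d h * d h * (d h * d h))).
  { apply (bigO_mult 2 2); apply (bigO_mult 1 1); auto. }
  set (k := fun h => RtoC 1 / 2 + d h / 6).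
  (* with k = 1/2 + d/6 the cubic Taylor polynomial is p = d + d^2 k, and
     d - (p - p^2/2 + p^3/3) has no term below d^4 *)
  assert (K0 : bigO 0 k) by (unfold k, Cdiv; bounded).
  apply bigO_ext_near with (s := fun h =>
    - (r h * (1 - ((d h + d h * d h * k h) * 2 + r h) * / 2
         + ((d h + d h * d h * k h) * (d h + d h * d h * k h) * 3
            + (d h + d h * d h * k h) * r h * 3 + r h * r h) * / 3))
    - d h * d h * (d h * d h) * (k h - / 6 - k h * k h * / 2
         + d h * (k h * k h) + d h * d h * (k h * k h * k h) * / 3)).
  - apply bigO_minus; [apply bigO_opp; apply bigO_mult0; auto; bounded |].
    bigO_terms.
  - apply near_imp with (1 := Hn). intros h _ E. rewrite <- E. unfold r, k. field.
Qed.

(** * Complex power series in the unit disc *)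

Definition Cseries (u : nat -> C) (l : C) : Prop :=
  @is_series C_AbsRing C_NormedModule u l.

Lemma Cseries_eventually (u : nat -> C) (l : C) :
  Cseries u l -> forall e : R, (0 < e)%R ->
  exists N, forall n, (N <= n)%nat ->
  (Cmod (@sum_n C_AbelianMonoid u n - l) < e)%R.
Proof.
  intros H e He. assert (He2 : (0 < e / 2)%R) by lra.
  destruct (H _ (locally_ball l (mkposreal _ He2))) as [N HN].
  exists N. intros n Hn. specialize (HN n Hn). apply ball_Cmod in HN.
  replace e with (2 * (e / 2))%R by field. exact HN.
Qed.

Lemma sum_n_C_S (u : nat -> C) (n : nat) :
  @sum_n C_AbelianMonoid u (S n) = @sum_n C_AbelianMonoid u n + u (S n).
Proof. apply (@sum_Sn C_AbelianMonoid). Qed.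

Lemma Cseries_plus (u v : nat -> C) (l m : C) :
  Cseries u l -> Cseries v m -> Cseries (fun n => u n + v n) (l + m).
Proof. apply (@is_series_plus C_AbsRing C_NormedModule). Qed.

Lemma Cseries_scal (c : C) (u : nat -> C) (l : C) :
  Cseries u l -> Cseries (fun n => c * u n) (c * l).
Proof. apply (@is_series_scal C_AbsRing C_NormedModule c). Qed.

Lemma Cseries_ext (u v : nat -> C) (l : C) :
  (forall n, u n = v n) -> Cseries u l -> Cseries v l.
Proof. apply (@is_series_ext C_AbsRing C_NormedModule). Qed.

Lemma Cseries_Cmod_le (u : nat -> C) (l : C) (v : nat -> R) (L : R) :
  Cseries u l -> is_series v L -> (forall n, (Cmod (u n) <= v n)%R) ->
  (Cmod l <= L)%R.
Proof.
  intros Hu Hv H.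
  assert (S1 : forall n, (Cmod (@sum_n C_AbelianMonoid u n) <= sum_n v n)%R).
  { induction n.
    - rewrite !sum_O. apply H.
    - rewrite sum_n_C_S, sum_Sn. eapply Rle_trans; [apply Cmod_triangle |].
      apply Rplus_le_compat; auto. }
  apply le_epsilon. intros e He. assert (He2 : (0 < e / 2)%R) by lra.
  destruct (Cseries_eventually _ _ Hu _ He2) as [N HN].
  destruct (Hv _ (locally_ball L (mkposreal _ He2))) as [N' HN'].
  specialize (HN (N + N')%nat ltac:(lia)). specialize (HN' (N + N')%nat ltac:(lia)).
  specialize (S1 (N + N')%nat).
  assert (HN2 : (Rabs (sum_n v (N + N') - L) < e / 2)%R) by exact HN'.
  apply Rabs_lt_between in HN2.
  pose proof (Cmod_triangle_inv l (@sum_n C_AbelianMonoid u (N + N'))) as T.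
  rewrite Cmod_sub_sym in T. lra.
Qed.

Lemma Cseries_unique (u : nat -> C) (l m : C) : Cseries u l -> Cseries u m -> l = m.
Proof.
  intros Hl Hm. apply Ceq_minus, Cmod_eq_0.
  apply Rle_antisym; [| apply Cmod_ge_0].
  apply (Cseries_Cmod_le (fun n => u n + - RtoC 1 * u n) _ (fun _ => 0%R)).
  - replace (l - m) with (l + - RtoC 1 * m) by ring.
    apply Cseries_plus; auto. now apply Cseries_scal.
  - apply is_series_Reals. intros e He. exists 0%nat. intros n _.
    rewrite sum_cte, Rmult_0_l. unfold Rdist. now rewrite Rminus_0_r, Rabs_R0.
  - intros n. replace (u n + - RtoC 1 * u n) with (RtoC 0) by ring.
    rewrite Cmod_0. lra.
Qed.

Lemma Cseries_ex (u : nat -> C) (v : nat -> R) :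
  (forall n, (Cmod (u n) <= v n)%R) -> ex_series v -> exists l, Cseries u l.
Proof. apply (@ex_series_le C_AbsRing C_CompleteNormedModule). Qed.

Lemma finite_upper_bound (x : nat -> R) (N : nat) :
  exists M : R, (0 <= M)%R /\ forall n, (n <= N)%nat -> (x n <= M)%R.
Proof.
  induction N as [| N [M [HM IH]]].
  - exists (Rabs (x 0%nat)). split; [apply Rabs_pos |].
    intros n Hn. replace n with 0%nat by lia. apply Rle_abs.
  - exists (M + Rabs (x (S N)))%R. pose proof (Rabs_pos (x (S N))).
    split; [lra |]. intros n Hn. destruct (Nat.eq_dec n (S N)) as [-> | E].
    + pose proof (Rle_abs (x (S N))). lra.
    + specialize (IH n ltac:(lia)). lra.
Qed.

Lemma Cseries_bounded (u : nat -> C) (l : C) :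
  Cseries u l -> exists M : R, (0 <= M)%R /\ forall n, (Cmod (u n) <= M)%R.
Proof.
  intros H. destruct (Cseries_eventually _ _ H 1%R ltac:(lra)) as [N HN].
  destruct (finite_upper_bound (fun n => Cmod (u n)) N) as [M [HM HF]]. exists (M + 2)%R. split; [lra |].
  intros n. destruct (Nat.le_gt_cases n N) as [Hn | Hn]; [specialize (HF n Hn); lra |].
  destruct n as [| n]; [lia |].
  pose proof (HN n ltac:(lia)) as H1. pose proof (HN (S n) ltac:(lia)) as H2.
  rewrite sum_n_C_S in H2. set (s := @sum_n C_AbelianMonoid u n) in *.
  replace (u (S n)) with ((s + u (S n) - l) - (s - l)) by ring.
  eapply Rle_trans; [apply Cmod_triangle |]. rewrite Cmod_opp. lra.
Qed.

Lemma Cseries_S (u : nat -> C) (l : C) :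
  Cseries u l -> Cseries (fun n => u (S n)) (l - u 0%nat).
Proof.
  intros H. apply (@is_series_incr_1 C_AbsRing C_NormedModule).
  change (Cseries u (l - u 0%nat + u 0%nat)).
  now replace (l - u 0%nat + u 0%nat) with l by ring.
Qed.

(** Cauchy's estimates for every radius below 1: equivalent to convergence in the
    disc, and easier to transport along operations on coefficients. *)
Definition tame (a : nat -> C) : Prop :=
  forall rho : R, (0 < rho < 1)%R ->
  exists M : R, (0 <= M)%R /\ forall n, (Cmod (a n) * rho ^ n <= M)%R.

Definition sums_to (a : nat -> C) (f : C -> C) : Prop :=
  forall z, disc z -> Cseries (fun n => a n * z ^ n) (f z).

Lemma sums_to_pseries (a : nat -> C) (f : C -> C) :
  sums_to a f <->
  forall z, disc z -> @is_pseries C_AbsRing C_NormedModule a z (f z).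
Proof.
  split; intros H z Hz; specialize (H z Hz); revert H;
    apply Cseries_ext; intros n.
  - exact (Cmult_comm (a n) (z ^ n)).
  - exact (Cmult_comm (z ^ n) (a n)).
Qed.

Lemma sums_to_tame (a : nat -> C) (f : C -> C) : sums_to a f -> tame a.
Proof.
  intros H rho Hr. assert (Hd : disc (RtoC rho)).
  { unfold disc. rewrite Cmod_R, Rabs_pos_eq; lra. }
  destruct (Cseries_bounded _ _ (H _ Hd)) as [M [HM B]].
  exists M; split; auto. intros n. specialize (B n).
  rewrite Cmod_mult, Cmod_pow, Cmod_R, Rabs_pos_eq in B; lra.
Qed.

Lemma tame_series (a : nat -> C) (r : R) :
  tame a -> (0 <= r < 1)%R -> ex_series (fun n => (Cmod (a n) * r ^ n)%R).
Proof.
  intros Ha Hr. set (rho := ((1 + r) / 2)%R).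
  assert (Hrho : (0 < rho < 1 /\ r < rho)%R) by (unfold rho; lra).
  destruct (Ha rho ltac:(lra)) as [M [HM B]].
  apply (@ex_series_le R_AbsRing R_CompleteNormedModule _
    (fun n => scal M ((r / rho) ^ n))%R).
  - intros n. change (Rabs (Cmod (a n) * r ^ n) <= M * (r / rho) ^ n)%R.
    rewrite Rabs_pos_eq.
    2:{ apply Rmult_le_pos; [apply Cmod_ge_0 | apply pow_le; lra]. }
    replace (Cmod (a n) * r ^ n)%R
      with ((Cmod (a n) * rho ^ n) * (r / rho) ^ n)%R.
    + apply Rmult_le_compat_r; auto. apply pow_le.
      apply Rdiv_le_0_compat; lra.
    + rewrite Rmult_assoc, <- Rpow_mult_distr. do 2 f_equal. field. lra.
  - apply (@ex_series_scal R_AbsRing R_NormedModule). apply ex_series_geom.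
    rewrite Rabs_pos_eq by (apply Rdiv_le_0_compat; lra).
    apply Rmult_lt_reg_r with rho; [lra |]. field_simplify; lra.
Qed.

(** The sum is a function on all of [C], chosen arbitrarily off the disc. *)
Lemma tame_sums_to (a : nat -> C) : tame a -> exists f, sums_to a f.
Proof.
  intros Ha.
  exists (fun z => epsilon (inhabits (RtoC 0)) (Cseries (fun n => a n * z ^ n))).
  intros z Hz. apply epsilon_spec.
  apply (Cseries_ex _ (fun n => Cmod (a n) * Cmod z ^ n)%R).
  - intros n. rewrite Cmod_mult, Cmod_pow. lra.
  - apply tame_series; auto. split; [apply Cmod_ge_0 | apply Hz].
Qed.

Lemma n_pow_bounded (q : R) :
  (0 < q < 1)%R -> exists K : R, (0 <= K)%R /\ forall n, (INR (S n) * q ^ n <= K)%R.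
Proof.
  intros Hq. set (x := (/ q - 1)%R).
  assert (Hx : (0 < x)%R).
  { unfold x. assert (1 < / q)%R by (rewrite <- Rinv_1; apply Rinv_lt_contravar; lra).
    lra. }
  exists (1 + / x)%R. split. { pose proof (Rinv_0_lt_compat x Hx). lra. }
  intros n. pose proof (poly n x Hx) as P.
  assert (Q : (q ^ n * (1 + x) ^ n = 1)%R).
  { rewrite <- Rpow_mult_distr. replace (q * (1 + x))%R with 1%R by (unfold x; field; lra).
    apply pow1. }
  assert (Pq : (0 < q ^ n)%R) by (apply pow_lt; lra).
  assert (Q1 : (q ^ n <= 1)%R) by (rewrite <- (pow1 n); apply pow_incr; lra).
  rewrite S_INR, Rmult_plus_distr_r.
  assert (INR n * q ^ n <= / x)%R.
  { apply Rmult_le_reg_r with x; auto. rewrite Rinv_l by lra.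
    rewrite <- Q. pose proof (pos_INR n). nra. }
  lra.
Qed.

(** A polynomial factor is absorbed by an arbitrarily small increase of the
    radius. *)
Lemma tame_mult_n (a : nat -> C) : tame a -> tame (fun n => RtoC (INR (S n)) * a n).
Proof.
  intros Ha r Hr. set (rho := ((1 + r) / 2)%R).
  assert (Hrho : (0 < rho < 1 /\ r < rho)%R) by (unfold rho; lra).
  destruct (Ha rho ltac:(lra)) as [M [HM B]].
  assert (Hq : (0 < r / rho < 1)%R).
  { split; [apply Rdiv_lt_0_compat; lra |].
    apply Rmult_lt_reg_r with rho; [lra |]. field_simplify; lra. }
  destruct (n_pow_bounded _ Hq) as [K [HK BK]].
  exists (M * K)%R. split; [now apply Rmult_le_pos |]. intros n.
  rewrite Cmod_mult, Cmod_R, Rabs_pos_eq by apply pos_INR.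
  replace (INR (S n) * Cmod (a n) * r ^ n)%R
    with ((Cmod (a n) * rho ^ n) * (INR (S n) * (r / rho) ^ n))%R.
  - apply Rmult_le_compat; auto.
    + apply Rmult_le_pos; [apply Cmod_ge_0 | apply pow_le; lra].
    + apply Rmult_le_pos; [apply pos_INR | apply pow_le; lra].
  - replace (r ^ n)%R with (rho ^ n * (r / rho) ^ n)%R; [ring |].
    rewrite <- Rpow_mult_distr. f_equal. field. lra.
Qed.

Lemma tame_S (a : nat -> C) : tame a -> tame (fun n => a (S n)).
Proof.
  intros Ha r Hr. destruct (Ha r Hr) as [M [HM B]].
  exists (M / r)%R. split; [apply Rdiv_le_0_compat; lra |].
  intros n. specialize (B (S n)). simpl in B.
  apply Rmult_le_reg_r with r; [lra |]. field_simplify; [| lra].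
  replace (Cmod (a (S n)) * r ^ n * r)%R with (Cmod (a (S n)) * (r * r ^ n))%R by ring.
  lra.
Qed.

Definition dcoef (a : nat -> C) (n : nat) : C := RtoC (INR (S n)) * a (S n).

Lemma tame_dcoef (a : nat -> C) : tame a -> tame (dcoef a).
Proof. intros H. apply (tame_mult_n (fun n => a (S n))). now apply tame_S. Qed.

(** The first two Taylor coefficients in [h] of [(z + h) ^ n], and the
    remainder, by the recursions that expanding [(z + h) * (z + h) ^ n] gives. *)
Fixpoint pow_d1 (z : C) (n : nat) : C :=
  match n with O => RtoC 0 | S m => z * pow_d1 z m + z ^ m end.

Fixpoint pow_d2 (z : C) (n : nat) : C :=
  match n with O => RtoC 0 | S m => z * pow_d2 z m + pow_d1 z m end.

Definition pow_rem (z h : C) (n : nat) : C :=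
  (z + h) ^ n + - RtoC 1 * z ^ n + - h * pow_d1 z n + - h ^ 2 * pow_d2 z n.

Lemma pow_rem_S (z h : C) (n : nat) :
  pow_rem z h (S n) = (z + h) * pow_rem z h n + h ^ 3 * pow_d2 z n.
Proof. unfold pow_rem; simpl. ring. Qed.

Lemma pow_d1_S (z : C) (n : nat) : pow_d1 z (S n) = RtoC (INR (S n)) * z ^ n.
Proof.
  induction n as [| n IH].
  - simpl. ring.
  - change (pow_d1 z (S (S n))) with (z * pow_d1 z (S n) + z ^ S n).
    rewrite IH, (S_INR (S n)), RtoC_plus. simpl (z ^ S n). ring.
Qed.

(** The recursions lose one power of [n] at each order; the powers of [rho] on the
    left avoid the truncated exponents [n - 1], [n - 2], [n - 3]. *)
Lemma pow_rem_bounds (z h : C) (rho : R) (n : nat) :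
  (0 < rho)%R -> (Cmod z <= rho)%R -> (Cmod (z + h) <= rho)%R ->
  (rho * Cmod (pow_d1 z n) <= INR (S n) * rho ^ n /\
   rho ^ 2 * Cmod (pow_d2 z n) <= INR (S n) ^ 2 * rho ^ n /\
   rho ^ 3 * Cmod (pow_rem z h n) <= INR (S n) ^ 3 * rho ^ n * Cmod h ^ 3)%R.
Proof.
  intros Hr Hz Hzh. pose proof (Cmod_ge_0 h) as Hh.
  assert (H3 : (0 <= Cmod h ^ 3)%R) by now apply pow_le.
  induction n as [| n [IH1 [IH2 IH3]]].
  - assert (E : pow_rem z h 0 = RtoC 0) by (unfold pow_rem; simpl; ring).
    rewrite E. simpl. rewrite Cmod_0. simpl in H3. lra.
  - rewrite (S_INR (S n)). set (N := INR (S n)) in *.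
    assert (HN : (1 <= N)%R) by (unfold N; rewrite S_INR; pose proof (pos_INR n); lra).
    assert (Pn : (0 < rho ^ n)%R) by now apply pow_lt.
    assert (Zn : (Cmod z ^ n <= rho ^ n)%R) by (apply pow_incr; split; [apply Cmod_ge_0 | auto]).
    pose proof (Cmod_ge_0 (pow_d1 z n)) as P1.
    pose proof (Cmod_ge_0 (pow_d2 z n)) as P2.
    pose proof (Cmod_ge_0 (pow_rem z h n)) as P3.
    assert (mul : forall s t u v w : R, (0 <= s <= t -> 0 <= u -> u * w <= v -> 0 <= w ->
       s * u * w <= t * v)%R).
    { intros s t u v w Hs Hu Hv Hw. rewrite Rmult_assoc.
      apply Rmult_le_compat; try lra. now apply Rmult_le_pos. }
    pose proof (Cmod_ge_0 z) as Pz. pose proof (Cmod_ge_0 (z + h)) as Pzh.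
    split; [| split].
    + simpl pow_d1. apply Rle_trans with (rho * (Cmod z * Cmod (pow_d1 z n) + Cmod z ^ n))%R.
      { apply Rmult_le_compat_l; [lra |]. rewrite <- Cmod_mult, <- Cmod_pow.
        apply Cmod_triangle. }
      assert (A := mul (Cmod z) rho rho _ _ ltac:(lra) ltac:(lra) IH1 P1).
      simpl. nra.
    + simpl pow_d2.
      apply Rle_trans with (rho ^ 2 * (Cmod z * Cmod (pow_d2 z n) + Cmod (pow_d1 z n)))%R.
      { apply Rmult_le_compat_l; [now apply pow_le, Rlt_le |]. rewrite <- Cmod_mult.
        apply Cmod_triangle. }
      assert (A := mul (Cmod z) rho (rho ^ 2)%R _ _ ltac:(lra)
        ltac:(apply pow_le; lra) IH2 P2).
      assert (B : (rho ^ 2 * Cmod (pow_d1 z n) <= rho * (N * rho ^ n))%R).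
      { replace (rho ^ 2 * Cmod (pow_d1 z n))%R
          with (rho * (rho * Cmod (pow_d1 z n)))%R by ring.
        apply Rmult_le_compat_l; lra. }
      apply Rle_trans with (rho * (N ^ 2 * rho ^ n) + rho * (N * rho ^ n))%R; [lra |].
      replace (rho * (N ^ 2 * rho ^ n) + rho * (N * rho ^ n))%R
        with ((N ^ 2 + N) * rho ^ S n)%R by (simpl; ring).
      apply Rmult_le_compat_r; [apply pow_le; lra | nra].
    + rewrite pow_rem_S.
      apply Rle_trans with (rho ^ 3 * (Cmod (z + h) * Cmod (pow_rem z h n)
        + Cmod h ^ 3 * Cmod (pow_d2 z n)))%R.
      { apply Rmult_le_compat_l; [now apply pow_le, Rlt_le |].
        rewrite <- Cmod_mult, <- Cmod_pow, <- Cmod_mult. apply Cmod_triangle. }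
      assert (A := mul (Cmod (z + h)) rho (rho ^ 3)%R _ _ ltac:(lra)
        ltac:(apply pow_le; lra) IH3 P3).
      assert (B : (rho ^ 3 * (Cmod h ^ 3 * Cmod (pow_d2 z n))
                   <= (rho * Cmod h ^ 3) * (N ^ 2 * rho ^ n))%R).
      { replace (rho ^ 3 * (Cmod h ^ 3 * Cmod (pow_d2 z n)))%R
          with ((rho * Cmod h ^ 3) * (rho ^ 2 * Cmod (pow_d2 z n)))%R by ring.
        apply Rmult_le_compat_l; auto. apply Rmult_le_pos; lra. }
      apply Rle_trans with (rho * (N ^ 3 * rho ^ n * Cmod h ^ 3)
        + (rho * Cmod h ^ 3) * (N ^ 2 * rho ^ n))%R; [lra |].
      replace (rho * (N ^ 3 * rho ^ n * Cmod h ^ 3)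
        + (rho * Cmod h ^ 3) * (N ^ 2 * rho ^ n))%R
        with ((N ^ 3 + N ^ 2) * (rho ^ S n * Cmod h ^ 3))%R by (simpl; ring).
      rewrite (Rmult_assoc ((N + 1) ^ 3)).
      apply Rmult_le_compat_r; [apply Rmult_le_pos; auto; apply pow_le; lra | nra].
Qed.

(** Term-by-term differentiation: the third-order remainders of the monomials
    are summable against tame coefficients. *)
Lemma sums_to_jet (a : nat -> C) (f f' : C -> C) (z : C) :
  sums_to a f -> sums_to (dcoef a) f' -> disc z ->
  exists q, bigO 3 (fun h => f (z + h) - (f z + f' z * h + q * h ^ 2)).
Proof.
  intros Hf Hf' Hz. unfold disc in Hz. pose proof (Cmod_ge_0 z) as Pz.
  set (rho := ((1 + Cmod z) / 2)%R).
  assert (Hr : (0 < rho < 1 /\ Cmod z < rho)%R) by (unfold rho; lra).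
  (* the coefficients (n + 1)^3 a_n dominate the Taylor terms and the remainders *)
  set (b := fun n => RtoC (INR (S n)) * (RtoC (INR (S n)) * (RtoC (INR (S n)) * a n))).
  assert (Hb : tame b).
  { do 3 apply tame_mult_n. now apply sums_to_tame with f. }
  destruct (tame_series b rho Hb ltac:(lra)) as [L HL].
  assert (Eb : forall n, Cmod (b n) = (INR (S n) ^ 3 * Cmod (a n))%R).
  { intros n. unfold b. rewrite !Cmod_mult, Cmod_R, Rabs_pos_eq by apply pos_INR. ring. }
  assert (HD1 : Cseries (fun n => a n * pow_d1 z n) (f' z)).
  { apply (@is_series_decr_1 C_AbsRing C_NormedModule).
    change (Cseries (fun n => a (S n) * pow_d1 z (S n)) (f' z - a 0%nat * RtoC 0)).
    replace (f' z - a 0%nat * RtoC 0) with (f' z) by ring.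
    generalize (Hf' z Hz). apply Cseries_ext. intros n.
    rewrite pow_d1_S. unfold dcoef. ring. }
  assert (HD2 : exists q, Cseries (fun n => a n * pow_d2 z n) q).
  { apply (Cseries_ex _ (fun n => scal (/ rho ^ 2) (Cmod (b n) * rho ^ n))%R).
    - intros n. change (Cmod (a n * pow_d2 z n) <= / rho ^ 2 * (Cmod (b n) * rho ^ n))%R.
      destruct (pow_rem_bounds z (RtoC 0) rho n) as [_ [B _]]; try lra.
      { replace (z + RtoC 0) with z by ring. lra. }
      rewrite Cmod_mult, Eb. assert (P2 : (0 < rho ^ 2)%R) by (apply pow_lt; lra).
      apply Rmult_le_reg_l with (rho ^ 2)%R; auto.
      replace (rho ^ 2 * (/ rho ^ 2 * (INR (S n) ^ 3 * Cmod (a n) * rho ^ n)))%R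
        with (INR (S n) ^ 3 * Cmod (a n) * rho ^ n)%R by (field; lra).
      pose proof (Cmod_ge_0 (a n)) as Pa.
      assert (N1 : (1 <= INR (S n))%R) by (rewrite S_INR; pose proof (pos_INR n); lra).
      apply Rle_trans with (Cmod (a n) * (INR (S n) ^ 2 * rho ^ n))%R.
      { replace (rho ^ 2 * (Cmod (a n) * Cmod (pow_d2 z n)))%R
          with (Cmod (a n) * (rho ^ 2 * Cmod (pow_d2 z n)))%R by ring.
        now apply Rmult_le_compat_l. }
      replace (INR (S n) ^ 3 * Cmod (a n) * rho ^ n)%R
        with (Cmod (a n) * (INR (S n) * (INR (S n) ^ 2 * rho ^ n)))%R by ring.
      apply Rmult_le_compat_l; auto.
      rewrite <- (Rmult_1_l (INR (S n) ^ 2 * rho ^ n)) at 1.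
      apply Rmult_le_compat_r; auto.
      apply Rmult_le_pos; apply pow_le; lra.
    - apply (@ex_series_scal R_AbsRing R_NormedModule). now exists L. }
  destruct HD2 as [q HD2]. exists q.
  assert (P3 : (0 < / rho ^ 3)%R) by (apply Rinv_0_lt_compat, pow_lt; lra).
  assert (L0 : (0 <= L)%R).
  { apply Rle_trans with (Cmod (RtoC 0)); [rewrite Cmod_0; lra |].
    apply (Cseries_Cmod_le (fun n => RtoC 0 * (a n * z ^ n)) _ _ _) with (2 := HL).
    - pose proof (Cseries_scal (RtoC 0) _ _ (Hf z Hz)) as H0.
      rewrite (Cmult_0_l (f z)) in H0. exact H0.
    - intros n. cbv beta. rewrite Cmult_0_l, Cmod_0. apply Rmult_le_pos; [apply Cmod_ge_0 | apply pow_le; lra]. }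
  exists (/ rho ^ 3 * L)%R. split. { apply Rmult_le_pos; lra. }
  exists (rho - Cmod z)%R. split; [lra |]. intros h _ Hh.
  assert (Hzh : (Cmod (z + h) <= rho)%R).
  { eapply Rle_trans; [apply Cmod_triangle | lra]. }
  assert (Hd : disc (z + h)) by (unfold disc; lra).
  apply (Cseries_Cmod_le (fun n => a n * pow_rem z h n) _
    (fun n => scal (/ rho ^ 3 * Cmod h ^ 3) (Cmod (b n) * rho ^ n))%R).
  - pose proof (Cseries_plus _ _ _ _ (Cseries_plus _ _ _ _
      (Cseries_plus _ _ _ _ (Hf _ Hd) (Cseries_scal (- RtoC 1) _ _ (Hf _ Hz)))
      (Cseries_scal (- h) _ _ HD1)) (Cseries_scal (- h ^ 2) _ _ HD2)) as H.
    replace (f (z + h) - (f z + f' z * h + q * h ^ 2))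
      with (f (z + h) + - RtoC 1 * f z + - h * f' z + - h ^ 2 * q) by ring.
    revert H. apply Cseries_ext. intros n. unfold pow_rem. ring.
  - replace (/ rho ^ 3 * L * Cmod h ^ 3)%R
      with (/ rho ^ 3 * Cmod h ^ 3 * L)%R by ring.
    apply (@is_series_scal R_AbsRing R_NormedModule). exact HL.
  - intros n. change (Cmod (a n * pow_rem z h n)
      <= / rho ^ 3 * Cmod h ^ 3 * (Cmod (b n) * rho ^ n))%R.
    destruct (pow_rem_bounds z h rho n) as [_ [_ B]]; try lra.
    rewrite Cmod_mult, Eb. apply Rmult_le_reg_l with (rho ^ 3)%R; [apply pow_lt; lra |].
    replace (rho ^ 3 * (/ rho ^ 3 * Cmod h ^ 3 * (INR (S n) ^ 3 * Cmod (a n) * rho ^ n)))%R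
      with (Cmod (a n) * (INR (S n) ^ 3 * rho ^ n * Cmod h ^ 3))%R by (field; lra).
    replace (rho ^ 3 * (Cmod (a n) * Cmod (pow_rem z h n)))%R
      with (Cmod (a n) * (rho ^ 3 * Cmod (pow_rem z h n)))%R by ring.
    apply Rmult_le_compat_l; auto using Cmod_ge_0.
Qed.

Lemma sums_to_smooth2 (a : nat -> C) (f : C -> C) (z : C) :
  sums_to a f -> disc z -> smooth2 f z.
Proof.
  intros Hf Hz. destruct (tame_sums_to _ (tame_dcoef _ (sums_to_tame _ _ Hf))) as [f' Hf'].
  exists (f' z). now apply sums_to_jet with a.
Qed.

Lemma sums_to_deriv_at (a : nat -> C) (f f' : C -> C) (z : C) :
  sums_to a f -> sums_to (dcoef a) f' -> disc z -> deriv_at f z (f' z).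
Proof.
  intros Hf Hf' Hz. destruct (sums_to_jet a f f' z Hf Hf' Hz) as [q H].
  apply (bigO_le 3 2) in H; [| lia].
  apply bigO_ext with (s := fun h =>
    (f (z + h) - (f z + f' z * h + q * h ^ 2)) + h ^ 2 * q).
  - bigO_terms.
  - intros; ring.
Qed.

Lemma disc_0 : disc (RtoC 0).
Proof. unfold disc. rewrite Cmod_0. lra. Qed.

Lemma sums_to_0 (a : nat -> C) (f : C -> C) : sums_to a f -> f (RtoC 0) = a 0%nat.
Proof.
  intros H. apply Ceq_minus, Cmod_eq_0. apply Rle_antisym; [| apply Cmod_ge_0].
  pose proof (Cseries_S _ _ (H _ disc_0)) as HS. simpl in HS.
  replace (f (RtoC 0) - a 0%nat) with (f (RtoC 0) - a 0%nat * 1) by ring.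
  apply (Cseries_Cmod_le _ _ (fun _ => 0%R) 0%R HS).
  - apply is_series_Reals. intros e He. exists 0%nat. intros n _.
    rewrite sum_cte, Rmult_0_l. unfold Rdist. now rewrite Rminus_0_r, Rabs_R0.
  - intros n. rewrite Cmult_0_l, Cmult_0_r, Cmod_0. lra.
Qed.

Lemma sums_to_bounded (a : nat -> C) (f : C -> C) : sums_to a f -> bigO 0 f.
Proof.
  intros H. pose proof (sums_to_smooth2 _ _ _ H disc_0) as Hs.
  apply smooth2_bigO1 in Hs.
  apply bigO_ext with
    (s := fun h => (f (RtoC 0 + h) - f (RtoC 0)) + f (RtoC 0)).
  - bounded.
  - intros h _. replace (RtoC 0 + h) with h by ring. ring.
Qed.

Lemma sums_to_tail (a : nat -> C) (f : C -> C) :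
  sums_to a f -> exists g, sums_to (fun n => a (S n)) g /\
  forall z, disc z -> f z = a 0%nat + z * g z.
Proof.
  intros H. destruct (tame_sums_to _ (tame_S _ (sums_to_tame _ _ H))) as [g Hg].
  exists g; split; auto. intros z Hz.
  pose proof (Cseries_S _ _ (H z Hz)) as H1.
  pose proof (Cseries_scal z _ _ (Hg z Hz)) as H2.
  rewrite <- (Cseries_unique (fun n => a (S n) * z ^ S n) (f z - a 0%nat * z ^ 0) (z * g z)).
  - simpl. ring.
  - exact H1.
  - revert H2. apply Cseries_ext. intros n. simpl. ring.
Qed.

Lemma near_disc : near disc.
Proof. exists 1%R; split; [lra | auto]. Qed.

Lemma sums_to_taylor3 (a : nat -> C) (f : C -> C) : sums_to a f ->
  bigO 4 (fun h => f h - (a 0%nat + a 1%nat * h + a 2%nat * h ^ 2 + a 3%nat * h ^ 3)).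
Proof.
  intros H. destruct (sums_to_tail _ _ H) as [f1 [H1 E1]].
  destruct (sums_to_tail _ _ H1) as [f2 [H2 E2]].
  destruct (sums_to_tail _ _ H2) as [f3 [H3 E3]].
  destruct (sums_to_tail _ _ H3) as [f4 [H4 E4]].
  apply bigO_ext_near with (s := fun h => h ^ 4 * f4 h).
  - apply sums_to_bounded in H4. bigO_terms.
  - apply near_imp with (1 := near_disc). intros h _ Hh.
    rewrite E1, E2, E3, E4 by auto. ring.
Qed.

(** * The maximum principle in the punctured disc *)

(** Existence of a maximum point, by compactness of a square containing the
    annulus. *)
Lemma usc_attains_max_on_annulus (phi : C -> R) (s r B : R) (z1 : C) :
  (s <= Cmod z1 <= r)%R ->
  (forall z, (s <= Cmod z <= r)%R -> (phi z <= B)%R) ->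
  (forall z e, (s <= Cmod z <= r)%R -> (0 < e)%R ->
     exists d : R, (0 < d)%R /\
     forall w, (Cmod (w - z) < d)%R -> (phi w < phi z + e)%R) ->
  exists z, (s <= Cmod z <= r)%R /\
  forall w, (s <= Cmod w <= r)%R -> (phi w <= phi z)%R.
Proof.
  intros H1 HB Hc. apply NNPP. intros Hno.
  destruct (completeness (fun y => exists z, (s <= Cmod z <= r)%R /\ y = phi z))
    as [M [HM1 HM2]].
  { exists B. intros y [z [Hz ->]]. auto. }
  { exists (phi z1), z1. auto. }
  assert (Hlt : forall z, (s <= Cmod z <= r)%R -> (phi z < M)%R).
  { intros z Hz. destruct (Rle_lt_or_eq_dec (phi z) M) as [L | E]; auto.
    - apply HM1. exists z; auto.
    - exfalso. apply Hno. exists z. split; auto. intros w Hw. rewrite E. apply HM1.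
      exists w; auto. }
  (* around each point, a radius on which phi stays clearly below its supremum,
     and which is itself a lower bound of the gap *)
  assert (Hd : forall x y : R, exists d : posreal, forall w, (s <= Cmod w <= r)%R ->
    (Cmod (w - (x, y)) < 2 * d)%R -> (phi w < M - d)%R).
  { intros x y. set (z := (x, y)).
    destruct (Rlt_dec (Cmod z) s) as [L1 | L1].
    { assert (Hp : (0 < (s - Cmod z) / 2)%R) by lra.
      exists (mkposreal _ Hp). simpl. intros w Hw Hwz.
      pose proof (Cmod_triangle_inv w z). lra. }
    destruct (Rlt_dec r (Cmod z)) as [L2 | L2].
    { assert (Hp : (0 < (Cmod z - r) / 2)%R) by lra.
      exists (mkposreal _ Hp). simpl. intros w Hw Hwz.
      pose proof (Cmod_triangle_inv z w) as T. rewrite Cmod_sub_sym in T. lra. }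
    assert (Hz : (s <= Cmod z <= r)%R) by lra. specialize (Hlt z Hz).
    destruct (Hc z ((M - phi z) / 2)%R Hz ltac:(lra)) as [d [Hd Hw]].
    assert (Hp : (0 < Rmin (d / 2) ((M - phi z) / 2))%R) by (apply Rmin_glb_lt; lra).
    exists (mkposreal _ Hp). simpl. intros w _ Hwz.
    pose proof (Rmin_l (d / 2) ((M - phi z) / 2)).
    pose proof (Rmin_r (d / 2) ((M - phi z) / 2)).
    specialize (Hw w ltac:(lra)). lra. }
  set (delta := fun x y => proj1_sig (constructive_indefinite_description _ (Hd x y))).
  destruct (compactness_value_2d (- r) r (- r) r delta) as [d Hcomp].
  assert (Hw : exists w, (s <= Cmod w <= r)%R /\ (M - d < phi w)%R).
  { apply NNPP. intros Hn. assert (M <= M - d)%R; [| pose proof (cond_pos d); lra].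
    apply HM2. intros y [z [Hz ->]]. apply Rnot_lt_le. intros Hl. apply Hn.
    exists z; auto. }
  destruct Hw as [w [Hw Hwd]]. destruct w as [x y].
  pose proof (Rmax_Cmod (x, y)) as Hm. simpl in Hm.
  assert (Hx : (Rabs x <= r)%R) by (pose proof (Rmax_l (Rabs x) (Rabs y)); lra).
  assert (Hy : (Rabs y <= r)%R) by (pose proof (Rmax_r (Rabs x) (Rabs y)); lra).
  apply Rabs_le_between in Hx. apply Rabs_le_between in Hy.
  apply (Hcomp x y Hx Hy). intros [u [v [_ [_ [Hu [Hv Hduv]]]]]].
  unfold delta in *. destruct constructive_indefinite_description as [e He].
  simpl in *. specialize (He (x, y) Hw).
  assert (Hclose : (Cmod ((x, y) - (u, v)) < 2 * e)%R).
  { eapply Rle_lt_trans; [apply Cmod_2Rmax |]. simpl.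
    pose proof (sqrt_sqrt 2 ltac:(lra)). pose proof (sqrt_pos 2).
    assert (Rmax (Rabs (x - u)) (Rabs (y - v)) < e)%R by (now apply Rmax_lub_lt).
    assert (0 <= Rmax (Rabs (x - u)) (Rabs (y - v)))%R
      by (eapply Rle_trans; [apply Rabs_pos | apply Rmax_l]).
    assert (sqrt 2 <= 2)%R by nra.
    unfold Rminus in *. nra. }
  specialize (He Hclose). lra.
Qed.

(** Averaging over [t], [i t], [- t], [- i t] kills the cross terms between
    different powers of [h], exactly and not only to leading order. *)
Lemma four_point_sum (g p q : C) (t : R) :
  (Cmod (g + p * (t, 0%R) + q * (t, 0%R) ^ 2) ^ 2
   + Cmod (g + p * (0%R, t) + q * (0%R, t) ^ 2) ^ 2
   + Cmod (g + p * (- t, 0)%R + q * (- t, 0)%R ^ 2) ^ 2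
   + Cmod (g + p * (0, - t)%R + q * (0, - t)%R ^ 2) ^ 2
   = 4 * (Cmod g ^ 2 + Cmod p ^ 2 * t ^ 2 + Cmod q ^ 2 * t ^ 4))%R.
Proof.
  destruct g, p, q. rewrite !Cmod2_alt. unfold Re, Im, Cplus, Cmult; simpl. ring.
Qed.

(** The mean of [|G|^2 + e |z|^2] over the vertices of a small square exceeds its
    value at the centre: the linear and quadratic terms of [G] average out, up to
    nonnegative quantities. *)
Lemma no_interior_max (G : C -> C) (z : C) (e : R) :
  smooth2 G z -> (0 < e)%R ->
  ~ near (fun h => (Cmod (G (z + h)%C) ^ 2 + e * Cmod (z + h)%C ^ 2
                    <= Cmod (G z) ^ 2 + e * Cmod z ^ 2)%R).
Proof.
  intros [p [q [K [HK [d [Hd H]]]]]] He [d' [Hd' Hm]].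
  (* bounds the Taylor polynomial of G on the square *)
  set (S := (Cmod (G z) + Cmod p + Cmod q)%R).
  pose proof (Cmod_ge_0 (G z)) as P0. pose proof (Cmod_ge_0 p) as P1.
  pose proof (Cmod_ge_0 q) as P2.
  assert (HS : (0 <= S)%R) by (unfold S; lra).
  assert (HSK : (0 <= S * K)%R) by now apply Rmult_le_pos.
  set (t := (Rmin (Rmin d d') (Rmin 1 (e / (4 * (S * K + 1)))) / 2)%R).
  assert (Hq : (0 < e / (4 * (S * K + 1)))%R) by (apply Rdiv_lt_0_compat; lra).
  assert (Ht : (0 < t /\ t < d /\ t < d' /\ t < 1 /\ t < e / (4 * (S * K + 1)))%R).
  { pose proof (Rmin_l (Rmin d d') (Rmin 1 (e / (4 * (S * K + 1))))).
    pose proof (Rmin_r (Rmin d d') (Rmin 1 (e / (4 * (S * K + 1))))).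
    pose proof (Rmin_l d d'). pose proof (Rmin_r d d').
    pose proof (Rmin_l 1 (e / (4 * (S * K + 1)))).
    pose proof (Rmin_r 1 (e / (4 * (S * K + 1)))).
    assert (0 < Rmin (Rmin d d') (Rmin 1 (e / (4 * (S * K + 1)))))%R
      by (repeat apply Rmin_glb_lt; lra).
    unfold t. lra. }
  destruct Ht as [T0 [T1 [T2 [T3 T4]]]].
  assert (step : forall h, Cmod h = t ->
    (Cmod (G z + p * h + q * h ^ 2)%C ^ 2 - 2 * S * K * t ^ 3
       + e * Cmod (z + h)%C ^ 2 <= Cmod (G z) ^ 2 + e * Cmod z ^ 2)%R).
  { intros h Hh. assert (h0 : h <> RtoC 0) by (apply Cmod_gt_0; lra).
    specialize (H h h0 ltac:(lra)). specialize (Hm h h0 ltac:(lra)).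
    rewrite Hh in H. set (A := G z + p * h + q * h ^ 2) in *.
    assert (HA : (Cmod A <= S)%R).
    { unfold A, S. eapply Rle_trans; [apply Cmod_triangle |].
      apply Rplus_le_compat.
      - eapply Rle_trans; [apply Cmod_triangle |]. apply Rplus_le_compat_l.
        rewrite Cmod_mult, Hh. nra.
      - rewrite Cmod_mult, Cmod_pow, Hh. assert (t ^ 2 <= 1)%R by nra. nra. }
    pose proof (Cmod_triangle_inv A (G (z + h))) as T. rewrite Cmod_sub_sym in T.
    pose proof (Cmod_ge_0 A) as PA. pose proof (Cmod_ge_0 (G (z + h))) as PG.
    assert (Pt : (0 <= K * t ^ 3)%R) by (apply Rmult_le_pos; auto; apply pow_le; lra).
    assert (Cmod A ^ 2 - 2 * S * (K * t ^ 3) <= Cmod (G (z + h)%C) ^ 2)%R.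
    { destruct (Rle_dec (Cmod A) (K * t ^ 3)) as [L | L].
      - assert (Cmod A * Cmod A <= S * (K * t ^ 3))%R by (apply Rmult_le_compat; auto).
        nra.
      - nra. }
    lra. }
  assert (M1 : Cmod (t, 0%R) = t).
  { change (t, 0%R) with (RtoC t). rewrite Cmod_R. apply Rabs_pos_eq; lra. }
  assert (M2 : Cmod (0%R, t) = t).
  { replace (0%R, t) with (Ci * RtoC t).
    - rewrite Cmod_mult, Cmod_Ci, Cmod_R, Rabs_pos_eq; lra.
    - unfold Ci, RtoC, Cmult; simpl. f_equal; ring. }
  assert (M3 : Cmod (- t, 0)%R = t).
  { rewrite <- M1 at 2. rewrite <- Cmod_opp. f_equal. unfold Copp; simpl. f_equal; ring. }
  assert (M4 : Cmod (0, - t)%R = t).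
  { rewrite <- M2 at 2. rewrite <- Cmod_opp. f_equal. unfold Copp; simpl. f_equal; ring. }
  pose proof (step _ M1) as S1. pose proof (step _ M2) as S2.
  pose proof (step _ M3) as S3. pose proof (step _ M4) as S4.
  pose proof (four_point_sum (G z) p q t) as Q1.
  pose proof (four_point_sum z (RtoC 1) (RtoC 0) t) as Q2.
  rewrite Cmod_1, Cmod_0, !Cmult_1_l, !Cmult_0_l, !Cplus_0_r in Q2.
  assert (P3 : (0 <= Cmod p ^ 2 * t ^ 2)%R) by (apply Rmult_le_pos; apply pow2_ge_0).
  assert (P4 : (0 <= Cmod q ^ 2 * t ^ 4)%R) by (apply Rmult_le_pos; apply pow_le; lra).
  assert (F : (4 * e * t ^ 2 <= 8 * S * K * t ^ 3)%R) by nra.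
  assert (F2 : (e <= 2 * (S * K) * t)%R).
  { apply Rmult_le_reg_r with (t ^ 2)%R; [apply pow_lt; lra |]. nra. }
  apply Rmult_lt_compat_l with (r := (4 * (S * K + 1))%R) in T4; [| lra].
  replace (4 * (S * K + 1) * (e / (4 * (S * K + 1))))%R with e in T4 by (field; lra).
  nra.
Qed.

Lemma near_shift (P : C -> Prop) (z : C) (d : R) :
  (0 < d)%R -> (forall w, (Cmod (w - z) < d)%R -> P w) -> near (fun h => P (z + h)).
Proof.
  intros Hd H. exists d; split; auto. intros h _ Hh. apply H.
  replace (z + h - z) with h by ring. auto.
Qed.

(** The maximum of [|G|^2 + e |z|^2] over a closed annulus cannot lie inside by
    [no_interior_max], nor on the inner circle if that is small, as [G] tends to 0
    at the centre. *)
Lemma max_modulus (G : C -> C) (r B D : R) :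
  (0 < r < 1)%R -> (0 <= B)%R ->
  (forall z, (0 < Cmod z < 1)%R -> smooth2 G z) ->
  (forall z, (0 < Cmod z < 1)%R -> (Cmod (G z) <= D)%R) ->
  bigO 1 G ->
  (forall z, Cmod z = r -> (Cmod (G z) <= B)%R) ->
  forall z, (0 < Cmod z < r)%R -> (Cmod (G z) <= B)%R.
Proof.
  intros Hr HB Hs HD HO Hb z1 Hz1. apply Rnot_lt_le. intros Hlt.
  set (a := Cmod (G z1)) in *.
  set (e := ((a ^ 2 - B ^ 2) / 2)%R). assert (He : (0 < e)%R) by (unfold e; nra).
  set (phi := fun z => (Cmod (G z) ^ 2 + e * Cmod z ^ 2)%R).
  destruct HO as [K [HK [d [Hd HO]]]].
  (* radius below which phi is smaller than at z1 *)
  set (s := (Rmin (Rmin d (Cmod z1)) (Rmin 1 (a ^ 2 / (K ^ 2 + e + 1))) / 2)%R).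
  assert (Hq : (0 < a ^ 2 / (K ^ 2 + e + 1))%R).
  { apply Rdiv_lt_0_compat; [nra |]. pose proof (pow2_ge_0 K). lra. }
  assert (Hs' : (0 < s /\ s < d /\ s < Cmod z1 /\ s < 1 /\ s < a ^ 2 / (K ^ 2 + e + 1))%R).
  { pose proof (Rmin_l (Rmin d (Cmod z1)) (Rmin 1 (a ^ 2 / (K ^ 2 + e + 1)))).
    pose proof (Rmin_r (Rmin d (Cmod z1)) (Rmin 1 (a ^ 2 / (K ^ 2 + e + 1)))).
    pose proof (Rmin_l d (Cmod z1)). pose proof (Rmin_r d (Cmod z1)).
    pose proof (Rmin_l 1 (a ^ 2 / (K ^ 2 + e + 1))).
    pose proof (Rmin_r 1 (a ^ 2 / (K ^ 2 + e + 1))).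
    assert (0 < Rmin (Rmin d (Cmod z1)) (Rmin 1 (a ^ 2 / (K ^ 2 + e + 1))))%R
      by (repeat apply Rmin_glb_lt; lra).
    unfold s. lra. }
  destruct Hs' as [s0 [s1 [s2 [s3 s4]]]].
  destruct (usc_attains_max_on_annulus phi s r (D ^ 2 + e)%R z1) as [z [Hz Hmax]].
  - lra.
  - intros z Hz. unfold phi. specialize (HD z ltac:(lra)).
    pose proof (Cmod_ge_0 (G z)). pose proof (Cmod_ge_0 z). apply Rplus_le_compat.
    + apply pow_incr; auto.
    + assert (Cmod z ^ 2 <= 1)%R by nra. nra.
  - intros z e' Hz He'. pose proof (smooth2_bigO1 _ _ (Hs z ltac:(lra))) as H1.
    (* continuity of phi, from that of G and of the modulus *)
    set (c := (2 * Cmod (G z) + 1 + e * (2 * Cmod z + 1))%R).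
    pose proof (Cmod_ge_0 (G z)) as P1. pose proof (Cmod_ge_0 z) as P2.
    assert (Pe : (0 <= e * (2 * Cmod z + 1))%R) by (apply Rmult_le_pos; lra).
    assert (Hc : (0 < c)%R) by (unfold c; lra).
    assert (Hec : (0 < Rmin 1 (e' / c))%R)
      by (apply Rmin_glb_lt; [lra | apply Rdiv_lt_0_compat; lra]).
    pose proof (Rmin_l 1 (e' / c)) as M1. pose proof (Rmin_r 1 (e' / c)) as M2.
    set (m := Rmin 1 (e' / c)) in *.
    assert (Hcm : (c * m <= e')%R).
    { apply Rmult_le_compat_l with (r := c) in M2; [| lra].
      replace (c * (e' / c))%R with e' in M2 by (field; lra). lra. }
    destruct (bigO_near_le _ m Hec H1) as [d1 [Hd1 Hn]].
    exists (Rmin d1 m). split; [now apply Rmin_glb_lt |]. intros w Hw.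
    pose proof (Rmin_l d1 m). pose proof (Rmin_r d1 m).
    destruct (Ceq_dec (w - z) (RtoC 0)) as [E | E].
    { apply Ceq_minus in E. subst w. lra. }
    specialize (Hn _ E ltac:(lra)). replace (z + (w - z)) with w in Hn by ring.
    pose proof (Cmod_triangle_inv (G w) (G z)) as T1.
    pose proof (Cmod_triangle_inv w z) as T2.
    pose proof (Cmod_ge_0 (G w)) as P3. pose proof (Cmod_ge_0 w) as P4.
    unfold phi.
    assert (A1 : (Cmod (G w) ^ 2 < Cmod (G z) ^ 2 + (2 * Cmod (G z) + 1) * m)%R) by nra.
    assert (A2 : (Cmod w ^ 2 <= Cmod z ^ 2 + (2 * Cmod z + 1) * m)%R) by nra.
    apply Rmult_le_compat_l with (r := e) in A2; [| lra].
    unfold c in Hcm. nra.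
  - assert (Hz1' : (phi z1 <= phi z)%R) by (apply Hmax; lra).
    assert (Hphi1 : (a ^ 2 < phi z1)%R).
    { unfold phi. fold a. assert (0 < e * Cmod z1 ^ 2)%R; [| lra].
      apply Rmult_lt_0_compat; auto. apply pow_lt; lra. }
    assert (Hint : (s < Cmod z < r)%R).
    { destruct (Req_dec (Cmod z) s) as [E | E]; [exfalso |].
      - assert (z0 : z <> RtoC 0) by (apply Cmod_gt_0; lra).
        specialize (HO z z0 ltac:(lra)). rewrite E in HO. simpl in HO.
        rewrite Rmult_1_r in HO. pose proof (Cmod_ge_0 (G z)).
        assert (phi z <= (K ^ 2 + e) * s ^ 2)%R by (unfold phi; rewrite E; nra).
        apply Rmult_lt_compat_l with (r := (K ^ 2 + e + 1)%R) in s4;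
          [| pose proof (pow2_ge_0 K); lra].
        replace ((K ^ 2 + e + 1) * (a ^ 2 / (K ^ 2 + e + 1)))%R with (a ^ 2)%R in s4
          by (field; pose proof (pow2_ge_0 K); lra).
        assert (s ^ 2 <= s)%R by nra. pose proof (pow2_ge_0 K).
        assert ((K ^ 2 + e) * s ^ 2 <= (K ^ 2 + e + 1) * s)%R by nra. lra.
      - destruct (Req_dec (Cmod z) r) as [E' | E']; [exfalso | lra].
        specialize (Hb z E'). pose proof (Cmod_ge_0 (G z)).
        assert (Cmod (G z) ^ 2 <= B ^ 2)%R by (apply pow_incr; auto).
        assert (e * r ^ 2 <= e)%R by (assert (r ^ 2 <= 1)%R by nra; nra).
        assert (phi z <= B ^ 2 + e)%R by (unfold phi; rewrite E'; lra).
        unfold e in *. lra. }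
    apply (no_interior_max G z e); auto. { apply Hs; lra. }
    apply (near_shift (fun w => Cmod (G w) ^ 2 + e * Cmod w ^ 2
      <= Cmod (G z) ^ 2 + e * Cmod z ^ 2)%R z (Rmin (Cmod z - s) (r - Cmod z))).
    { apply Rmin_glb_lt; lra. }
    intros w Hw. apply Hmax.
    pose proof (Rmin_l (Cmod z - s) (r - Cmod z)).
    pose proof (Rmin_r (Cmod z - s) (r - Cmod z)).
    pose proof (Cmod_triangle_inv w z). pose proof (Cmod_triangle_inv z w) as T.
    rewrite Cmod_sub_sym in T. lra.
Qed.

(** The Schwarz lemma, in the form that survives an isolated singularity: applied
    to [z g^N], the maximum principle loses only the bounded factor [|z|], which
    disappears in the [N]-th root. *)
Lemma schwarz_punctured (g : C -> C) (M D : R) :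
  (0 < M)%R ->
  (forall z, (0 < Cmod z < 1)%R -> smooth2 g z) ->
  (forall z, (0 < Cmod z < 1)%R -> (Cmod (g z) <= D)%R) ->
  (forall z, (0 < Cmod z < 1)%R -> (Cmod (z * g z) <= M)%R) ->
  forall z, (0 < Cmod z < 1)%R -> (Cmod (g z) <= M)%R.
Proof.
  intros HM Hs HD Hb z1 Hz1. apply Rnot_lt_le. intros Hlt.
  set (a := Cmod (g z1)) in *.
  assert (D0 : (0 <= D)%R).
  { eapply Rle_trans; [apply Cmod_ge_0 | apply (HD z1 Hz1)]. }
  assert (Hr : exists r, (Cmod z1 < r < 1 /\ M / r < a)%R).
  { exists ((1 + Rmax (Cmod z1) (M / a)) / 2)%R.
    assert (Q : (M / a < 1)%R).
    { apply Rmult_lt_reg_r with a; [lra |]. field_simplify; lra. }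
    pose proof (Rmax_l (Cmod z1) (M / a)). pose proof (Rmax_r (Cmod z1) (M / a)).
    assert (Rmax (Cmod z1) (M / a) < 1)%R by (apply Rmax_lub_lt; lra).
    split; [lra |]. set (r := ((1 + Rmax (Cmod z1) (M / a)) / 2)%R).
    assert (R1 : (M / a < r)%R) by (unfold r; lra).
    assert (R0 : (0 < r)%R) by (unfold r; lra).
    apply Rmult_lt_reg_r with (r / a)%R; [apply Rdiv_lt_0_compat; lra |].
    replace (M / r * (r / a))%R with (M / a)%R by (field; lra).
    replace (a * (r / a))%R with r by (field; lra). auto. }
  destruct Hr as [r [Hr Hra]]. set (b := (M / r)%R) in *.
  assert (Hb0 : (0 < b)%R) by (unfold b; apply Rdiv_lt_0_compat; lra).
  assert (Hpow : forall N, (Cmod z1 * a ^ N <= b ^ N)%R).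
  { intros N.
    assert (Hmax : (Cmod (z1 * g z1 ^ N) <= r * b ^ N)%R).
    { apply (max_modulus (fun z => z * g z ^ N) r _ (D ^ N)%R); try lra.
      - apply Rmult_le_pos; [lra | apply pow_le; lra].
      - intros z Hz. apply smooth2_mult; [apply smooth2_id |].
        apply smooth2_pow. auto.
      - intros z Hz. rewrite Cmod_mult, Cmod_pow. pose proof (Cmod_ge_0 (g z)).
        assert (Cmod (g z) ^ N <= D ^ N)%R by (apply pow_incr; auto).
        assert (0 <= D ^ N)%R by now apply pow_le.
        assert (0 <= Cmod (g z) ^ N)%R by now apply pow_le. nra.
      - apply (bigO_mult 1 0); [apply bigO_id |].
        exists (D ^ N)%R. split; [now apply pow_le |].
        exists 1%R; split; [lra |]. intros h h0 Hh. apply Cmod_gt_0 in h0.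
        rewrite Cmod_pow. simpl. rewrite Rmult_1_r. apply pow_incr.
        split; [apply Cmod_ge_0 | auto].
      - intros z Hz. rewrite Cmod_mult, Cmod_pow, Hz.
        apply Rmult_le_compat_l; [lra |]. apply pow_incr.
        split; [apply Cmod_ge_0 |]. unfold b.
        specialize (Hb z ltac:(lra)). rewrite Cmod_mult, Hz in Hb.
        apply Rmult_le_reg_l with r; [lra |]. field_simplify; lra. }
    rewrite Cmod_mult, Cmod_pow in Hmax. fold a in Hmax.
    assert (0 < b ^ N)%R by now apply pow_lt. nra. }
  set (x := (a / b - 1)%R).
  assert (Hx : (0 < x)%R).
  { unfold x. assert (1 < a / b)%R; [| lra].
    apply Rmult_lt_reg_r with b; auto. field_simplify; lra. }
  destruct (INR_unbounded (/ (Cmod z1 * x))) as [N HN].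
  pose proof (poly N x Hx) as P. specialize (Hpow N).
  assert (E : (b ^ N * (1 + x) ^ N = a ^ N)%R).
  { rewrite <- Rpow_mult_distr. f_equal. unfold x. field. lra. }
  assert (HbN : (0 < b ^ N)%R) by now apply pow_lt.
  rewrite <- E in Hpow.
  assert (Hf : (Cmod z1 * (1 + x) ^ N <= 1)%R).
  { apply Rmult_le_reg_l with (b ^ N)%R; auto. lra. }
  assert (Hzx : (0 < Cmod z1 * x)%R) by (apply Rmult_lt_0_compat; lra).
  apply Rmult_lt_compat_l with (r := (Cmod z1 * x)%R) in HN; auto.
  rewrite Rinv_r in HN by lra. nra.
Qed.

(** * Schur's algorithm for the first three coefficients *)

(** Schur functions with supremum below 1: the margin keeps every denominator of
    the algorithm away from 0 and is passed on from step to step. *)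
Definition schur (g : C -> C) : Prop :=
  exists m : R, (0 < m < 1)%R /\
  forall z, (0 < Cmod z < 1)%R -> smooth2 g z /\ (Cmod (g z) <= m)%R.

Definition schur_div (g : C -> C) (c z : C) : C :=
  (g z - c) / (z * (1 - Cconj c * g z)).

Lemma near_ex (P : C -> Prop) : near P -> exists h, h <> RtoC 0 /\ P h.
Proof.
  intros [d [Hd H]]. assert (M : Cmod (RtoC (d / 2)) = (d / 2)%R).
  { rewrite Cmod_R. apply Rabs_pos_eq; lra. }
  assert (h0 : RtoC (d / 2) <> RtoC 0) by (apply Cmod_gt_0; lra).
  exists (RtoC (d / 2)). split; auto. apply H; auto. lra.
Qed.

Lemma near_punctured_disc : near (fun h => (0 < Cmod h < 1)%R).
Proof.
  exists 1%R; split; [lra |]. intros h h0 Hh. split; auto. now apply Cmod_gt_0.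
Qed.

Lemma limit_le (g : C -> C) (c : C) (m : R) :
  bigO 1 (fun h => g h - c) ->
  (forall z, (0 < Cmod z < 1)%R -> (Cmod (g z) <= m)%R) -> (Cmod c <= m)%R.
Proof.
  intros Hc Hm. apply le_epsilon. intros e He.
  destruct (near_ex _ (near_and _ _ near_punctured_disc (bigO_near_le _ e He Hc)))
    as [h [_ [H1 H2]]].
  specialize (Hm h H1). pose proof (Cmod_triangle_inv c (g h)) as T.
  rewrite Cmod_sub_sym in T. lra.
Qed.

Lemma disc_automorphism_identity (c g : C) :
  (Cmod (1 - Cconj c * g) ^ 2 - Cmod (g - c) ^ 2
   = (1 - Cmod c ^ 2) * (1 - Cmod g ^ 2))%R.
Proof.
  destruct c as [a b], g as [x y]. rewrite !Cmod2_alt.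
  unfold Re, Im, Cconj, Cminus, Cplus, Copp, Cmult, RtoC; simpl. ring.
Qed.

Lemma Cconj_mult_Cmod (c : C) : Cconj c * c = RtoC (Cmod c ^ 2).
Proof. rewrite Cmod2_conj. ring. Qed.

Lemma one_minus_Cmod2_neq0 (c : C) : (Cmod c < 1)%R -> 1 - Cconj c * c <> RtoC 0.
Proof.
  intros Hc E. rewrite Cconj_mult_Cmod, <- RtoC_minus in E. apply RtoC_inj in E.
  pose proof (Cmod_ge_0 c). nra.
Qed.

Lemma one_minus_conj_mult_neq0 (c g : C) :
  (Cmod c < 1)%R -> (Cmod g < 1)%R -> 1 - Cconj c * g <> RtoC 0.
Proof.
  intros Hc Hg E. pose proof (disc_automorphism_identity c g) as I.
  rewrite E, Cmod_0 in I. pose proof (Cmod_ge_0 c). pose proof (Cmod_ge_0 g).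
  pose proof (pow2_ge_0 (Cmod (g - c))).
  assert (0 < (1 - Cmod c ^ 2) * (1 - Cmod g ^ 2))%R
    by (apply Rmult_lt_0_compat; nra).
  lra.
Qed.

(** One step of Schur's algorithm: a disc automorphism moves the value at the centre
    to 0 and keeps the supremum below 1; the Schwarz lemma then allows to divide by
    [z] without increasing that supremum. *)
Lemma schur_step (g : C -> C) (c : C) :
  schur g -> bigO 1 (fun h => g h - c) -> (Cmod c < 1)%R /\ schur (schur_div g c).
Proof.
  intros [m [Hm Hg]] Hc.
  assert (Hcm : (Cmod c <= m)%R) by (apply (limit_le g); auto; intros; now apply Hg).
  split; [lra |]. pose proof (Cmod_ge_0 c) as Pc.
  set (k := (1 - (1 - m ^ 2) ^ 2 / 4)%R).
  assert (Hk : (0 < k < 1)%R).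
  { unfold k. assert (0 < 1 - m ^ 2 < 1)%R by nra. nra. }
  assert (Hsk : (0 < sqrt k < 1)%R).
  { split; [apply sqrt_lt_R0; lra |]. rewrite <- sqrt_1. apply sqrt_lt_1_alt; lra. }
  assert (Hn0 : forall z, (0 < Cmod z < 1)%R -> 1 - Cconj c * g z <> RtoC 0).
  { intros z Hz. apply one_minus_conj_mult_neq0; [lra |].
    destruct (Hg z Hz). lra. }
  assert (Hz0 : forall z, (0 < Cmod z < 1)%R -> z <> RtoC 0)
    by (intros; apply Cmod_gt_0; lra).
  assert (Hs : forall z, (0 < Cmod z < 1)%R -> smooth2 (schur_div g c) z).
  { intros z Hz. destruct (Hg z Hz) as [Hsm _]. apply smooth2_div.
    - apply Cmult_neq_0; auto.
    - apply smooth2_minus; auto using smooth2_const.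
    - apply smooth2_mult; [apply smooth2_id |].
      apply smooth2_minus; [apply smooth2_const | now apply smooth2_scal]. }
  assert (Hb : forall z, (0 < Cmod z < 1)%R ->
            (Cmod (z * schur_div g c z) <= sqrt k)%R).
  { intros z Hz. destruct (Hg z Hz) as [_ B]. specialize (Hn0 z Hz).
    specialize (Hz0 z Hz). unfold schur_div.
    replace (z * ((g z - c) / (z * (1 - Cconj c * g z))))
      with ((g z - c) / (1 - Cconj c * g z)) by (field; auto).
    rewrite Cmod_div by auto. pose proof (disc_automorphism_identity c (g z)) as I.
    apply Cmod_gt_0 in Hn0. set (n := Cmod (1 - Cconj c * g z)) in *.
    assert (Hn2 : (n <= 2)%R).
    { unfold n. eapply Rle_trans; [apply Cmod_triangle |].
      rewrite Cmod_opp, Cmod_1, Cmod_mult, Cmod_conj.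
      assert (Cmod c * Cmod (g z) <= 1 * 1)%R
        by (apply Rmult_le_compat; try lra; apply Cmod_ge_0). lra. }
    pose proof (Cmod_ge_0 (g z)) as Pg. pose proof (Cmod_ge_0 (g z - c)) as Pd.
    assert (L : ((1 - m ^ 2) * (1 - m ^ 2) <= (1 - Cmod c ^ 2) * (1 - Cmod (g z) ^ 2))%R).
    { apply Rmult_le_compat; nra. }
    apply Rmult_le_reg_r with n; auto.
    replace (Cmod (g z - c) / n * n)%R with (Cmod (g z - c)) by (field; lra).
    apply Rsqr_incr_0_var; [| apply Rmult_le_pos; lra].
    unfold Rsqr. replace (sqrt k * n * (sqrt k * n))%R
      with ((sqrt k * sqrt k) * n ^ 2)%R by ring.
    rewrite sqrt_sqrt by lra. unfold k.
    assert (n ^ 2 <= 4)%R by nra. pose proof (pow2_ge_0 (1 - m ^ 2)). nra. }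
  exists (sqrt k). split; auto. intros z Hz. split; auto.
  (* a bound on the whole punctured disc: near 0 because g - c is O(h), elsewhere
     because z is bounded away from 0 *)
  assert (HO : bigO 0 (schur_div g c)).
  { apply bigO_ext with
      (s := fun h => (g h - c) / h * / (1 - Cconj c * g h)).
    - apply bigO_mult0; [now apply bigO_div |].
      apply bigO_inv with (c := 1 - Cconj c * c).
      + apply one_minus_Cmod2_neq0. lra.
      + apply bigO_ext with (s := fun h => (g h - c) * - Cconj c).
        * bigO_terms.
        * intros; ring.
    - intros h h0. unfold schur_div, Cdiv.
      destruct (Ceq_dec (1 - Cconj c * g h) (RtoC 0)) as [E | E].
      + rewrite E, Cmult_0_r. assert (Z : / RtoC 0 = RtoC 0).
        { unfold Cinv, RtoC; simpl. f_equal; unfold Rdiv; ring. }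
        rewrite Z. ring.
      + field. auto. }
  destruct HO as [K [HK [d [Hd HO]]]].
  apply (schwarz_punctured (schur_div g c) (sqrt k) (K + sqrt k / d)%R); auto; try lra.
  intros w Hw. destruct (Rlt_dec (Cmod w) d) as [L | L].
  - specialize (HO w (Hz0 w Hw) L). simpl in HO.
    assert (0 < sqrt k / d)%R by (apply Rdiv_lt_0_compat; lra). lra.
  - specialize (Hb w Hw). rewrite Cmod_mult in Hb.
    assert (Cmod (schur_div g c w) <= sqrt k / d)%R; [| lra].
    apply Rmult_le_reg_l with d; auto. replace (d * (sqrt k / d))%R with (sqrt k)
      by (field; lra).
    pose proof (Cmod_ge_0 (schur_div g c w)). nra.
Qed.

Lemma Cconj_0 : Cconj (RtoC 0) = RtoC 0.
Proof. unfold Cconj, RtoC; simpl. f_equal; ring. Qed.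

(** After the division by [z], two steps produce the Schur parameters [c1] and
    [zeta]; that the third parameter [s / (1 - |zeta|^2)] lies in the disc is the last inequality. *)
Lemma schur_coefficients (w : C -> C) (c1 c2 c3 : C) :
  schur w -> bigO 4 (fun h => w h - (c1 * h + c2 * h ^ 2 + c3 * h ^ 3)) ->
  (Cmod c1 < 1)%R /\ exists zeta s : C,
    c2 = (1 - Cconj c1 * c1) * zeta /\
    c3 = (1 - Cconj c1 * c1) * (s - Cconj c1 * zeta ^ 2) /\
    (Cmod zeta < 1)%R /\ (Cmod s <= 1 - Cmod zeta ^ 2)%R.
Proof.
  intros Hw H4.
  assert (O0 : bigO 1 (fun h => w h - RtoC 0)).
  { pose proof H4 as H. apply (bigO_le 4 1) in H; [| lia].
    apply bigO_ext with (s := fun h => (w h - (c1 * h + c2 * h ^ 2 + c3 * h ^ 3))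
      + h ^ 1 * (c1 + c2 * h + c3 * h ^ 2)); [bigO_terms | intros; ring]. }
  destruct (schur_step _ _ Hw O0) as [_ S1].
  set (g1 := schur_div w (RtoC 0)) in *.
  assert (J1 : bigO 3 (fun h => g1 h - (c1 + c2 * h + c3 * h ^ 2))).
  { apply bigO_div in H4. apply bigO_ext with (1 := H4). intros h h0.
    unfold g1, schur_div. rewrite Cconj_0. field. auto. }
  assert (O1 : bigO 1 (fun h => g1 h - c1)).
  { pose proof J1 as H. apply (bigO_le 3 1) in H; [| lia].
    apply bigO_ext with (s := fun h => (g1 h - (c1 + c2 * h + c3 * h ^ 2))
      + h ^ 1 * (c2 + c3 * h)); [bigO_terms | intros; ring]. }
  destruct (schur_step _ _ S1 O1) as [Hc1 S2]. split; auto.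
  set (g2 := schur_div g1 c1) in *. set (d := 1 - Cconj c1 * c1).
  assert (Hd : d <> RtoC 0) by (now apply one_minus_Cmod2_neq0).
  set (zeta := c2 / d). set (s := (c3 + zeta * Cconj c1 * c2) / d).
  exists zeta, s.
  assert (OD : bigO 1 (fun h => (1 - Cconj c1 * g1 h) - d)).
  { apply bigO_ext with (s := fun h => (g1 h - c1) * - Cconj c1);
      [bigO_terms | intros; unfold d; ring]. }
  assert (J2 : bigO 2 (fun h => g2 h - (zeta + s * h))).
  { set (r := fun h => g1 h - (c1 + c2 * h + c3 * h ^ 2)).
    assert (Hr : bigO 3 r) by exact J1.
    assert (Hr2 : bigO 2 (fun h => r h / h)) by now apply bigO_div.
    assert (Hr2' : bigO 2 r) by (apply (bigO_le 3 2); [lia | auto]).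
    apply bigO_ext_near with (s := fun h =>
      (r h / h + r h * (Cconj c1 * (zeta + s * h))
       + h ^ 2 * (Cconj c1 * (zeta * c3 + s * c2 + s * c3 * h)))
      * / (1 - Cconj c1 * g1 h)).
    - apply bigO_mult0; [| now apply bigO_inv with d].
      bigO_terms.
    - apply near_imp with (1 := bigO_near_neq0 _ _ Hd OD). intros h h0 [_ HD].
      unfold g2, schur_div, s, zeta, r in *.
      unfold d in *. field. auto. }
  assert (O2 : bigO 1 (fun h => g2 h - zeta)).
  { pose proof J2 as H. apply (bigO_le 2 1) in H; [| lia].
    apply bigO_ext with (s := fun h => (g2 h - (zeta + s * h)) + h ^ 1 * s);
      [bigO_terms | intros; ring]. }
  destruct (schur_step _ _ S2 O2) as [Hz S3].
  set (d2 := 1 - Cconj zeta * zeta).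
  assert (Hd2 : d2 <> RtoC 0) by (now apply one_minus_Cmod2_neq0).
  assert (OD2 : bigO 1 (fun h => (1 - Cconj zeta * g2 h) - d2)).
  { apply bigO_ext with (s := fun h => (g2 h - zeta) * - Cconj zeta);
      [bigO_terms | intros; unfold d2; ring]. }
  assert (J3 : bigO 1 (fun h => schur_div g2 zeta h - s / d2)).
  { set (r := fun h => g2 h - (zeta + s * h)).
    assert (Hr : bigO 2 r) by exact J2.
    assert (Hr2 : bigO 1 (fun h => r h / h)) by now apply bigO_div.
    assert (Hr2' : bigO 1 r) by (apply (bigO_le 2 1); [lia | auto]).
    apply bigO_ext_near with (s := fun h =>
      (r h / h + (r h + h ^ 1 * s) * (Cconj zeta * (s / d2)))
      * / (1 - Cconj zeta * g2 h)).
    - apply bigO_mult0; [| now apply bigO_inv with d2].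
      bigO_terms.
    - apply near_imp with (1 := bigO_near_neq0 _ _ Hd2 OD2). intros h h0 [_ HD].
      unfold schur_div, r in *. clearbody s zeta. unfold d2 in *. field. auto. }
  destruct S3 as [m [Hm HS3]].
  assert (B : (Cmod (s / d2) <= m)%R).
  { apply (limit_le (schur_div g2 zeta)); auto. intros; now apply HS3. }
  split; [unfold zeta; field; auto |].
  split; [unfold s, zeta; field; auto |]. split; auto.
  rewrite Cmod_div in B by auto.
  assert (E : Cmod d2 = (1 - Cmod zeta ^ 2)%R).
  { unfold d2. rewrite Cconj_mult_Cmod, <- RtoC_minus, Cmod_R. apply Rabs_pos_eq.
    pose proof (Cmod_ge_0 zeta). nra. }
  apply Cmod_gt_0 in Hd2. rewrite <- E.
  apply Rmult_le_compat_r with (r := Cmod d2) in B; [| lra].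
  replace (Cmod s / Cmod d2 * Cmod d2)%R with (Cmod s) in B by (field; lra). nra.
Qed.

(** The two-variable maximum behind the bound; it is attained at [t = 1],
    [c = 2 / sqrt 7]. *)
Lemma two_variable_maximum (c t : R) :
  (0 <= c <= 1 -> 0 <= t <= 1 ->
   (1 - c ^ 2) * (1 + c * t - (1 - c) * t ^ 2) + 5 / 6 * c ^ 3 <= 8 / (3 * sqrt 7))%R.
Proof.
  intros Hc Ht. set (x := (2 / sqrt 7)%R).
  pose proof (sqrt_lt_R0 7 ltac:(lra)) as S0. pose proof (sqrt_sqrt 7 ltac:(lra)) as SS.
  assert (Hx : (0 < x)%R) by (unfold x; apply Rdiv_lt_0_compat; lra).
  assert (Hx2 : (x ^ 2 = 4 / 7)%R).
  { unfold x. replace ((2 / sqrt 7) ^ 2)%R with (4 / (sqrt 7 * sqrt 7))%R by (field; lra).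
    rewrite SS. reflexivity. }
  assert (E : (8 / (3 * sqrt 7) = 4 / 3 * x)%R) by (unfold x; field; lra).
  rewrite E. destruct (Rle_dec c (2 / 3)) as [L | L].
  - apply Rle_trans with 1%R; [| nra].
    (* completing the square in t *)
    assert (A : ((1 - c ^ 2) * (1 + c * t - (1 - c) * t ^ 2)
      <= 1 - c ^ 2 + (1 + c) * c ^ 2 / 4)%R).
    { assert (0 <= (1 + c) * (c / 2 - (1 - c) * t) ^ 2)%R
        by (apply Rmult_le_pos; [lra | apply pow2_ge_0]). nra. }
    assert (0 <= c ^ 2 * (3 / 4 - 13 / 12 * c))%R
      by (apply Rmult_le_pos; [apply pow2_ge_0 | lra]). nra.
  - assert (A : (1 + c * t - (1 - c) * t ^ 2 <= 2 * c)%R).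
    { assert (0 <= (1 - t) * (2 * c - 1 - (1 - c) * t))%R
        by (apply Rmult_le_pos; nra). nra. }
    assert (B : ((1 - c ^ 2) * (1 + c * t - (1 - c) * t ^ 2) <= (1 - c ^ 2) * (2 * c))%R)
      by (apply Rmult_le_compat_l; nra).
    assert (P : (0 <= (c - x) ^ 2 * (c + 2 * x))%R)
      by (apply Rmult_le_pos; [apply pow2_ge_0 | lra]).
    replace ((c - x) ^ 2 * (c + 2 * x))%R
      with (c ^ 3 - 3 * c * x ^ 2 + 2 * x * x ^ 2)%R in P by ring.
    rewrite Hx2 in P. nra.
Qed.

(** Three times [a_4 - a_2 a_3] in terms of the coefficients of the subordinating
    function. *)
Definition coef_functional (c1 c2 c3 : C) : C := c3 + c1 * c2 - RtoC (5 / 6) * c1 ^ 3.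

(** In Schur parameters the triangle inequality loses nothing at the extremal
    point, so it reduces the bound to [two_variable_maximum]. *)
Lemma schur_coef_functional_bound (w : C -> C) (c1 c2 c3 : C) :
  schur w -> bigO 4 (fun h => w h - (c1 * h + c2 * h ^ 2 + c3 * h ^ 3)) ->
  (Cmod (coef_functional c1 c2 c3) <= 8 / (3 * sqrt 7))%R.
Proof.
  intros Hw H4.
  destruct (schur_coefficients _ _ _ _ Hw H4) as [Hc [zeta [s [-> [-> [Hz Hs]]]]]].
  pose proof (Cmod_ge_0 c1) as P1. pose proof (Cmod_ge_0 zeta) as P2.
  set (c := Cmod c1) in *. set (t := Cmod zeta) in *.
  eapply Rle_trans; [| apply (two_variable_maximum c t); lra].
  rewrite Cconj_mult_Cmod, <- RtoC_minus. fold c.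
  unfold coef_functional.
  replace (RtoC (1 - c ^ 2) * (s - Cconj c1 * zeta ^ 2) + c1 * (RtoC (1 - c ^ 2) * zeta)
    - RtoC (5 / 6) * c1 ^ 3)
    with (RtoC (1 - c ^ 2) * (s + - (Cconj c1 * zeta ^ 2) + c1 * zeta)
          + - (RtoC (5 / 6) * c1 ^ 3)) by ring.
  eapply Rle_trans; [apply Cmod_triangle |].
  rewrite Cmod_opp, !Cmod_mult, !Cmod_R, Cmod_pow. fold c.
  rewrite !Rabs_pos_eq by nra. apply Rplus_le_compat_r.
  apply Rmult_le_compat_l; [nra |].
  eapply Rle_trans; [apply Cmod_triangle |].
  eapply Rle_trans; [apply Rplus_le_compat_r, Cmod_triangle |].
  rewrite Cmod_opp, !Cmod_mult, Cmod_pow, Cmod_conj. fold c t. nra.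
Qed.

(** * The coefficient bound *)

(** A continuous logarithm of a function with a second-order expansion has one
    too.  In this way the subordinating function, of which only differentiability is
    known, inherits its regularity from [z f' / f]. *)
Lemma log_smooth2 (F w : C -> C) (z : C) :
  smooth2 F z -> F z = Cexp (w z) -> near (fun h => F (z + h) = Cexp (w (z + h))) ->
  (forall e, (0 < e)%R -> near (fun h => (Cmod (w (z + h)%C - w z) < e)%R)) ->
  smooth2 w z.
Proof.
  intros HF Ez En Hc. set (b := F z) in *.
  assert (b0 : b <> RtoC 0) by (rewrite Ez; apply Cexp_neq0).
  set (G := fun y => / b * F y - 1).
  assert (HG : smooth2 G z).
  { apply smooth2_minus; [now apply smooth2_scal | apply smooth2_const]. }
  assert (Gz : G z = RtoC 0) by (unfold G; fold b; field; auto).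
  set (L := fun y => G y - / 2 * G y ^ 2 + / 3 * G y ^ 3).
  assert (HL : smooth2 L z).
  { apply smooth2_plus; [apply smooth2_minus; auto |];
    apply smooth2_scal, smooth2_pow; auto. }
  assert (Lz : L z = RtoC 0) by (unfold L; rewrite Gz; simpl; ring).
  assert (H4 : bigO 4 (fun h => (w (z + h) - w z)
      - (G (z + h) - G (z + h) ^ 2 / 2 + G (z + h) ^ 3 / 3))).
  { apply (bigO_log (fun h => G (z + h)) (fun h => w (z + h) - w z)); auto.
    - apply bigO_ext with (1 := smooth2_bigO1 _ _ HG). intros h _. rewrite Gz. ring.
    - apply near_imp with (1 := En). intros h _ E. unfold G. rewrite E.
      replace (w (z + h) - w z) with (w (z + h) + - w z) by ring.
      rewrite Cexp_plus.
      pose proof (Cexp_opp_r (w z)) as I. rewrite <- Ez in I.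
      replace (Cexp (- w z)) with (/ b); [ring |].
      rewrite <- (Cmult_1_r (/ b)), <- I. field. auto. }
  apply (bigO_le 4 3) in H4; [| lia].
  destruct HL as [p [q HL]]. exists p, q. rewrite Lz in HL.
  apply bigO_ext with (1 := bigO_plus _ _ _ H4 HL).
  intros h _. unfold L. field.
Qed.

(** Here [w] stands for the logarithm of [1 + G], with [G] of order 1. *)
Lemma log_taylor3 (G w : C -> C) (q1 q2 q3 : C) :
  bigO 4 (fun h => G h - (q1 * h + q2 * h ^ 2 + q3 * h ^ 3)) ->
  bigO 4 (fun h => w h - (G h - G h ^ 2 / 2 + G h ^ 3 / 3)) ->
  bigO 4 (fun h => w h - (q1 * h + (q2 - q1 ^ 2 / 2) * h ^ 2
                          + (q3 - q1 * q2 + q1 ^ 3 / 3) * h ^ 3)).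
Proof.
  intros HG Hw.
  set (r := fun h => G h - (q1 * h + q2 * h ^ 2 + q3 * h ^ 3)) in *.
  set (P := fun h => q1 * h + q2 * h ^ 2 + q3 * h ^ 3).
  set (U := fun h => q1 + q2 * h + q3 * h ^ 2).
  set (V := fun h => q2 + q3 * h).
  assert (HP : bigO 0 P) by (unfold P; bounded).
  assert (HU : bigO 0 U) by (unfold U; bounded).
  assert (HV : bigO 0 V) by (unfold V; bounded).
  (* with P = h U and U = q1 + h V, the polynomial P - P^2/2 + P^3/3 differs from
     the claimed one by h^4 times the last bracket *)
  apply bigO_ext with (s := fun h =>
    (w h - (G h - G h ^ 2 / 2 + G h ^ 3 / 3))
    + r h * (1 - (2 * P h + r h) * / 2
             + (3 * P h * P h + 3 * P h * r h + r h * r h) * / 3)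
    + h ^ 4 * (- (q2 * q2 + 2 * q1 * q3 + 2 * q2 * q3 * h + q3 * q3 * h ^ 2) * / 2
               + V h * (q1 * q1 + q1 * U h + U h * U h) * / 3)).
  - bigO_terms.
  - intros h _. unfold r, P, U, V. field.
Qed.

(** The margin required by [schur] is removed by applying the bound to [rho w] and
    letting [rho] tend to 1. *)
Lemma coef_functional_closed_bound (w : C -> C) (c1 c2 c3 : C) :
  (forall z, (0 < Cmod z < 1)%R -> smooth2 w z /\ (Cmod (w z) <= 1)%R) ->
  bigO 4 (fun h => w h - (c1 * h + c2 * h ^ 2 + c3 * h ^ 3)) ->
  (Cmod (coef_functional c1 c2 c3) <= 8 / (3 * sqrt 7))%R.
Proof.
  intros Hw H4. apply le_epsilon. intros e He.
  set (x3 := Cmod c3). set (x2 := Cmod (c1 * c2)).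
  set (x1 := Cmod (RtoC (5 / 6) * c1 ^ 3)).
  assert (P1 : (0 <= x1)%R) by apply Cmod_ge_0.
  assert (P2 : (0 <= x2)%R) by apply Cmod_ge_0.
  assert (P3 : (0 <= x3)%R) by apply Cmod_ge_0.
  set (S := (x3 + 2 * x2 + 3 * x1)%R).
  assert (HS : (0 <= S)%R) by (unfold S; lra).
  set (eta := (e / (S + e + 1))%R).
  assert (Eeta : (eta * (S + e + 1) = e)%R) by (unfold eta; field; lra).
  assert (Heta : (0 < eta < 1)%R).
  { split; [unfold eta; apply Rdiv_lt_0_compat; lra |]. nra. }
  set (rho := (1 - eta)%R).
  assert (B : (Cmod (coef_functional (RtoC rho * c1) (RtoC rho * c2) (RtoC rho * c3))
               <= 8 / (3 * sqrt 7))%R).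
  { apply (schur_coef_functional_bound (fun z => RtoC rho * w z)).
    - exists rho. split; [unfold rho; lra |]. intros z Hz. destruct (Hw z Hz) as [Hs Hb].
      split; [now apply smooth2_scal |].
      rewrite Cmod_mult, Cmod_R, Rabs_pos_eq by (unfold rho; lra). unfold rho; nra.
    - apply bigO_ext with
        (s := fun h => (w h - (c1 * h + c2 * h ^ 2 + c3 * h ^ 3)) * RtoC rho).
      + bigO_terms.
      + intros; ring. }
  replace (coef_functional c1 c2 c3)
    with (coef_functional (RtoC rho * c1) (RtoC rho * c2) (RtoC rho * c3)
          + (RtoC (1 - rho) * c3 + RtoC (1 - rho ^ 2) * (c1 * c2)
             + RtoC (- (1 - rho ^ 3)) * (RtoC (5 / 6) * c1 ^ 3))).
  2:{ unfold coef_functional. rewrite RtoC_opp, !RtoC_minus, !RtoC_pow. ring. }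
  eapply Rle_trans; [apply Cmod_triangle |]. apply Rplus_le_compat; auto.
  eapply Rle_trans; [apply Cmod_triangle |].
  eapply Rle_trans; [apply Rplus_le_compat_r, Cmod_triangle |].
  rewrite (Cmod_mult (RtoC (1 - rho))), (Cmod_mult (RtoC (1 - rho ^ 2))),
    (Cmod_mult (RtoC (- (1 - rho ^ 3)))).
  fold x1 x2 x3. rewrite !Cmod_R, Rabs_Ropp.
  assert (E1 : (1 - rho = eta)%R) by (unfold rho; ring).
  assert (E2 : (0 <= 1 - rho ^ 2 <= 2 * eta)%R) by (unfold rho; nra).
  assert (E3 : (0 <= 1 - rho ^ 3 <= 3 * eta)%R).
  { unfold rho. split; [| nra].
    assert (0 <= eta * ((1 - eta) ^ 2 + (1 - eta) + 1))%R
      by (apply Rmult_le_pos; [lra |]; nra). nra. }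
  rewrite !Rabs_pos_eq by lra. rewrite E1. unfold S in Eeta. nra.
Qed.

(** Expanding [z f' / f] and its logarithm at the origin identifies
    [- 3 (a_2 a_3 - a_4)] with [coef_functional] of the coefficients of the
    subordinating function. *)
Lemma class_Se_bound (f : C -> C) (a : nat -> C) :
  class_Se f -> normalized_expansion f a ->
  (Cmod (a 2%nat * a 3%nat - a 4%nat)%C <= 8 / (9 * sqrt 7))%R.
Proof.
  intros [[Han [Hun [Hf0 Hd0]]] [w [Hwan [Hwd [Hw0 Hwe]]]]] [Ha0 [Ha1 Hsum]].
  apply sums_to_pseries in Hsum.
  destruct (sums_to_tail _ _ Hsum) as [v [Hv Ev]].
  destruct (tame_sums_to _ (tame_dcoef _ (sums_to_tame _ _ Hsum))) as [f' Hf'].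
  assert (Hder : forall z, disc z -> C_derive f z = f' z).
  { intros z Hz. apply is_C_derive_unique, deriv_at_is_derive.
    now apply sums_to_deriv_at with a. }
  assert (Hfv : forall z, disc z -> f z = z * v z).
  { intros z Hz. rewrite (Ev z Hz), Ha0. ring. }
  (* f vanishes only at 0, by univalence *)
  assert (v0 : forall z, (0 < Cmod z < 1)%R -> v z <> RtoC 0).
  { intros z Hz E. assert (Hz1 : disc z) by (unfold disc; lra).
    assert (z = RtoC 0).
    { apply Hun; auto using disc_0. rewrite Hf0, Hfv, E by auto. ring. }
    subst z. rewrite Cmod_0 in Hz. lra. }
  set (F := fun z => f' z / v z).
  assert (HFw : forall z, (0 < Cmod z < 1)%R -> F z = Cexp (w z)).
  { intros z Hz. assert (Hz1 : disc z) by (unfold disc; lra).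
    assert (z0 : z <> RtoC 0) by (apply Cmod_gt_0; lra).
    rewrite <- Hwe by auto. unfold log_quotient.
    destruct (Ceq_dec z (RtoC 0)) as [E | _]; [contradiction |].
    rewrite Hder, Hfv by auto. unfold F. field. auto. }
  assert (Hcont : forall z, disc z -> forall e, (0 < e)%R ->
            near (fun h => (Cmod (w (z + h)%C - w z) < e)%R)).
  { intros z Hz e He. apply ex_derive_continuous_near; auto. }
  assert (Hsmooth : forall z, (0 < Cmod z < 1)%R -> smooth2 w z).
  { intros z Hz. assert (Hz1 : disc z) by (unfold disc; lra).
    apply log_smooth2 with F; auto.
    - apply smooth2_div; auto.
      + now apply sums_to_smooth2 with (dcoef a).
      + now apply sums_to_smooth2 with (fun n => a (S n)).
    - apply (near_shift (fun y => F y = Cexp (w y)) z (Rmin (Cmod z) (1 - Cmod z))).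
      { apply Rmin_glb_lt; lra. }
      intros y Hy. apply HFw.
      pose proof (Rmin_l (Cmod z) (1 - Cmod z)). pose proof (Rmin_r (Cmod z) (1 - Cmod z)).
      pose proof (Cmod_triangle_inv y z). pose proof (Cmod_triangle_inv z y) as T.
      rewrite Cmod_sub_sym in T. lra. }
  set (q1 := a 2%nat). set (q2 := 2 * a 3%nat - a 2%nat ^ 2).
  set (q3 := 3 * a 4%nat - 3 * a 2%nat * a 3%nat + a 2%nat ^ 3).
  (* F v = f', so q1, q2, q3 result from dividing the two expansions *)
  assert (HG : bigO 4 (fun h => (F h - 1) - (q1 * h + q2 * h ^ 2 + q3 * h ^ 3))).
  { pose proof (sums_to_taylor3 _ _ Hv) as Tv.
    pose proof (sums_to_taylor3 _ _ Hf') as Tf. unfold dcoef in Tf.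
    cbv beta in Tv. rewrite Ha1 in Tv, Tf.
    set (rv := fun h => v h - (1 + a 2%nat * h + a 3%nat * h ^ 2 + a 4%nat * h ^ 3)).
    set (rf := fun h => f' h - (1 + 2 * a 2%nat * h + 3 * a 3%nat * h ^ 2
                                + 4 * a 4%nat * h ^ 3)).
    assert (Hrv : bigO 4 rv) by exact Tv.
    assert (Hrf : bigO 4 rf).
    { apply bigO_ext with (1 := Tf). intros h _. unfold rf.
      rewrite !S_INR. simpl INR. rewrite !RtoC_plus. ring. }
    assert (Hv1 : bigO 1 (fun h => v h - 1)).
    { apply bigO_ext with (s := fun h =>
        rv h + h ^ 1 * (a 2%nat + a 3%nat * h + a 4%nat * h ^ 2)).
      - apply bigO_plus; [apply (bigO_le 4 1); [lia | auto] | bigO_terms].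
      - intros; unfold rv; ring. }
    apply bigO_ext_near with (s := fun h =>
      (rf h - rv h * (1 + q1 * h + q2 * h ^ 2 + q3 * h ^ 3)
       - h ^ 4 * (a 2%nat * q3 + a 3%nat * q2 + a 4%nat * q1
                  + (a 3%nat * q3 + a 4%nat * q2) * h + a 4%nat * q3 * h ^ 2))
      * / v h).
    - apply bigO_mult0; [bigO_terms | now apply bigO_inv with (RtoC 1); [apply C1_nz |]].
    - apply near_imp with (1 := bigO_near_neq0 _ _ C1_nz Hv1). intros h _ [_ Hvh].
      unfold F, rf, rv, q1, q2, q3. field. auto. }
  assert (HL : bigO 4 (fun h => w h - ((F h - 1) - (F h - 1) ^ 2 / 2 + (F h - 1) ^ 3 / 3))).
  { apply (bigO_log (fun h => F h - 1) w).
    - intros e He. apply near_imp with (1 := Hcont _ disc_0 e He). intros h _.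
      rewrite Hw0. replace (RtoC 0 + h) with h by ring.
      replace (w h - RtoC 0) with (w h) by ring. auto.
    - pose proof HG as HG1. apply (bigO_le 4 1) in HG1; [| lia].
      apply bigO_ext with (s := fun h =>
        ((F h - 1) - (q1 * h + q2 * h ^ 2 + q3 * h ^ 3))
        + h ^ 1 * (q1 + q2 * h + q3 * h ^ 2)); [bigO_terms | intros; ring].
    - apply near_imp with (1 := near_punctured_disc). intros h _ Hh. now rewrite HFw. }
  pose proof (log_taylor3 (fun h => F h - 1) w _ _ _ HG HL) as HW.
  assert (HB := coef_functional_closed_bound w _ _ _ (fun z Hz =>
    conj (Hsmooth z Hz) (Rlt_le _ _ (Hwd z (proj2 Hz)))) HW).
  match type of HB with (Cmod ?x <= _)%R => replace x
    with (- RtoC 3 * (a 2%nat * a 3%nat - a 4%nat)) in HB end.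
  2:{ unfold coef_functional, q1, q2, q3. rewrite RtoC_div by lra. field. }
  rewrite Cmod_mult, Cmod_opp, Cmod_R, Rabs_pos_eq in HB by lra.
  pose proof (sqrt_lt_R0 7 ltac:(lra)) as S0.
  replace (8 / (3 * sqrt 7))%R with (3 * (8 / (9 * sqrt 7)))%R in HB by (field; lra).
  fold q1 in HB. lra.
Qed.

(** * Mean values along segments *)

Lemma deriv_at_segment (g : C -> C) (a D k d : C) (s : R) :
  deriv_at g (a + RtoC s * D) d ->
  is_derive (fun t : R => Re (k * g (a + RtoC t * D))) s (Re (k * d * D)).
Proof.
  intros [K [HK [r [Hr H]]]]. apply is_derive_Reals. intros e He.
  set (M := (Cmod k * K * Cmod D ^ 2)%R).
  pose proof (Cmod_ge_0 k) as Pk. pose proof (Cmod_ge_0 D) as PD.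
  assert (HM : (0 <= M)%R) by (unfold M; repeat apply Rmult_le_pos; try lra).
  assert (Hd : (0 < Rmin (r / (Cmod D + 1)) (e / (M + 1)))%R).
  { apply Rmin_glb_lt; apply Rdiv_lt_0_compat; lra. }
  exists (mkposreal _ Hd). simpl. intros t t0 Ht.
  assert (T1 : (Rabs t * (Cmod D + 1) < r)%R).
  { pose proof (Rmin_l (r / (Cmod D + 1)) (e / (M + 1))).
    apply Rmult_lt_reg_r with (/ (Cmod D + 1))%R; [apply Rinv_0_lt_compat; lra |].
    replace (Rabs t * (Cmod D + 1) * / (Cmod D + 1))%R with (Rabs t) by (field; lra).
    unfold Rdiv in *. lra. }
  assert (T2 : (Rabs t * (M + 1) < e)%R).
  { pose proof (Rmin_r (r / (Cmod D + 1)) (e / (M + 1))).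
    apply Rmult_lt_reg_r with (/ (M + 1))%R; [apply Rinv_0_lt_compat; lra |].
    replace (Rabs t * (M + 1) * / (M + 1))%R with (Rabs t) by (field; lra).
    unfold Rdiv in *. lra. }
  set (z := a + RtoC s * D) in *.
  assert (Pt : (0 < Rabs t)%R) by now apply Rabs_pos_lt.
  assert (Ez : a + RtoC (s + t) * D = z + RtoC t * D).
  { unfold z. rewrite RtoC_plus. ring. }
  change (Rabs ((Re (k * g (a + RtoC (s + t) * D))%C - Re (k * g z)%C) / t
                - Re (k * d * D)%C) < e)%R.
  rewrite Ez.
  assert (Eq : ((Re (k * g (z + RtoC t * D))%C - Re (k * g z)%C) / t - Re (k * d * D)%C
    = Re (k * (g (z + RtoC t * D) - g z - d * (RtoC t * D)))%C / t)%R).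
  { unfold Re, Cmult, Cminus, Cplus, Copp, RtoC; simpl. field. auto. }
  rewrite Eq. unfold Rdiv. rewrite Rabs_mult, Rabs_inv.
  apply Rmult_lt_reg_r with (Rabs t); auto.
  rewrite Rmult_assoc, Rinv_l, Rmult_1_r by lra.
  eapply Rle_lt_trans; [apply re_le_Cmod |]. rewrite Cmod_mult.
  assert (B : (Cmod (g (z + RtoC t * D) - g z - d * (RtoC t * D))%C
               <= K * (Rabs t * Cmod D) ^ 2)%R).
  { destruct (Ceq_dec (RtoC t * D) (RtoC 0)) as [Z | Z].
    - rewrite Z. replace (z + RtoC 0) with z by ring.
      replace (g z - g z - d * RtoC 0) with (RtoC 0) by ring. rewrite Cmod_0.
      apply Rmult_le_pos; auto. apply pow2_ge_0.
    - rewrite <- (Cmod_R t), <- Cmod_mult. apply H; auto.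
      rewrite Cmod_mult, Cmod_R. nra. }
  apply Rle_lt_trans with (Cmod k * (K * (Rabs t * Cmod D) ^ 2))%R.
  { apply Rmult_le_compat_l; auto. }
  replace (Cmod k * (K * (Rabs t * Cmod D) ^ 2))%R with ((Rabs t * M) * Rabs t)%R
    by (unfold M; ring).
  apply Rmult_lt_compat_r; auto. lra.
Qed.

(** A complex increment has no mean value, but each real-linear functional of it
    does; [k] selects the functional. *)
Lemma segment_mean_value (g : C -> C) (a D : C) (d : R -> C) :
  (forall s, (0 <= s <= 1)%R -> deriv_at g (a + RtoC s * D) (d s)) ->
  forall k, exists s, (0 <= s <= 1)%R /\
  Re (k * (g (a + D) - g a)) = Re (k * d s * D).
Proof.
  intros H k.
  destruct (MVT_gen (fun t : R => Re (k * g (a + RtoC t * D))) 0 1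
    (fun s => Re (k * d s * D))) as [s [Hs E]].
  - intros s Hs. rewrite Rmin_left, Rmax_right in Hs by lra.
    apply deriv_at_segment, H. lra.
  - intros s Hs. rewrite Rmin_left, Rmax_right in Hs by lra.
    apply continuity_pt_filterlim.
    apply (ex_derive_continuous (fun t : R => Re (k * g (a + RtoC t * D)))).
    exists (Re (k * d s * D)). apply deriv_at_segment, H. lra.
  - rewrite Rmin_left, Rmax_right in Hs by lra. exists s. split; auto.
    replace (a + RtoC 1 * D) with (a + D) in E by ring.
    replace (a + RtoC 0 * D) with a in E by ring.
    replace (Re (k * (g (a + D) - g a))) with (Re (k * g (a + D))%C - Re (k * g a)%C)%R.
    + rewrite E. ring.
    + unfold Re, Cmult, Cminus, Cplus, Copp; simpl. ring.
Qed.

Lemma zero_deriv_constant (g : C -> C) :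
  (forall z, disc z -> deriv_at g z (RtoC 0)) ->
  forall z, disc z -> g z = g (RtoC 0).
Proof.
  intros H z Hz.
  assert (Hs : forall s, (0 <= s <= 1)%R ->
            deriv_at g (RtoC 0 + RtoC s * z) (RtoC 0)).
  { intros s Hs. apply H. unfold disc in *.
    replace (RtoC 0 + RtoC s * z) with (RtoC s * z) by ring.
    rewrite Cmod_mult, Cmod_R, Rabs_pos_eq by lra.
    pose proof (Cmod_ge_0 z). nra. }
  destruct (segment_mean_value g (RtoC 0) z (fun _ => RtoC 0) Hs (RtoC 1)) as [_ [_ E1]].
  destruct (segment_mean_value g (RtoC 0) z (fun _ => RtoC 0) Hs Ci) as [_ [_ E2]].
  replace (RtoC 0 + z) with z in * by ring.
  revert E1 E2. destruct (g z) as [x y], (g (RtoC 0)) as [x' y'], z as [u v].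
  unfold Ci, Re, Cmult, Cminus, Cplus, Copp, RtoC; simpl. intros. f_equal; lra.
Qed.

(** The Noshiro-Warschawski criterion: if the derivative has positive real part
    along a segment, [g] separates its end points. *)
Lemma positive_real_part_injective (g : C -> C) (a b : C) (d : R -> C) :
  (forall s, (0 <= s <= 1)%R -> deriv_at g (a + RtoC s * (b - a)) (d s)) ->
  (forall s, (0 <= s <= 1)%R -> (0 < Re (d s))%R) -> g a = g b -> a = b.
Proof.
  intros H Hp E. destruct (Ceq_dec (b - a) (RtoC 0)) as [Z | Z].
  { symmetry. now apply Ceq_minus. }
  exfalso. destruct (segment_mean_value g a (b - a) d H (Cconj (b - a))) as [s [Hs M]].
  replace (a + (b - a)) with b in M by ring. rewrite E in M.
  replace (g b - g b) with (RtoC 0) in M by ring.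
  specialize (Hp s Hs). apply Cmod_gt_0 in Z.
  replace (Cconj (b - a) * d s * (b - a)) with (d s * (Cconj (b - a) * (b - a))) in M
    by ring.
  rewrite Cmult_0_r, Cconj_mult_Cmod, re_scal_r, re_RtoC in M.
  assert (0 < Cmod (b - a) ^ 2)%R by now apply pow_lt. nra.
Qed.

(** * The exponential of a power series *)

Lemma Cseries_iff (u : nat -> C) (l : C) :
  Cseries u l <-> is_series (fun n => fst (u n)) (fst l) /\
                  is_series (fun n => snd (u n)) (snd l).
Proof.
  assert (F : forall n, fst (@sum_n C_AbelianMonoid u n) = sum_n (fun k => fst (u k)) n).
  { induction n; [now rewrite !sum_O |]. rewrite sum_n_C_S, sum_Sn, <- IHn. reflexivity. }
  assert (S : forall n, snd (@sum_n C_AbelianMonoid u n) = sum_n (fun k => snd (u k)) n).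
  { induction n; [now rewrite !sum_O |]. rewrite sum_n_C_S, sum_Sn, <- IHn. reflexivity. }
  split.
  - intros H. split; apply filterlim_locally; intros eps;
      destruct (H _ (locally_ball l eps)) as [N HN]; exists N; intros n Hn;
      destruct (HN n Hn) as [H1 H2]; [rewrite <- F | rewrite <- S]; assumption.
  - intros [H1 H2]. apply filterlim_locally. intros eps.
    destruct (H1 _ (locally_ball (fst l) eps)) as [N1 HN1].
    destruct (H2 _ (locally_ball (snd l) eps)) as [N2 HN2].
    exists (N1 + N2)%nat. intros n Hn. split.
    + change (ball (fst l) eps (fst (@sum_n C_AbelianMonoid u n))). rewrite F.
      apply HN1. lia.
    + change (ball (snd l) eps (snd (@sum_n C_AbelianMonoid u n))). rewrite S.
      apply HN2. lia.
Qed.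

Definition cauchy_product (u v : nat -> C) (n : nat) : C :=
  @sum_n C_AbelianMonoid (fun k => u k * v (n - k)%nat) n.

Lemma Cseries_mult (u v : nat -> C) (l m : C) :
  Cseries u l -> Cseries v m ->
  ex_series (fun n => Cmod (u n)) -> ex_series (fun n => Cmod (v n)) ->
  Cseries (cauchy_product u v) (l * m).
Proof.
  intros Hu Hv Au Av.
  assert (abs : forall w : nat -> C, ex_series (fun n => Cmod (w n)) ->
    ex_series (fun n => Rabs (fst (w n))) /\ ex_series (fun n => Rabs (snd (w n)))).
  { intros w Hw. split;
    apply (@ex_series_le R_AbsRing R_CompleteNormedModule _ (fun n => Cmod (w n))); auto;
    intros n; (change norm with Rabs; rewrite Rabs_Rabsolu;
      eapply Rle_trans; [| apply Rmax_Cmod]; auto using Rmax_l, Rmax_r). }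
  destruct (abs u Au) as [Au1 Au2]. destruct (abs v Av) as [Av1 Av2].
  apply Cseries_iff in Hu, Hv. destruct Hu as [Hu1 Hu2], Hv as [Hv1 Hv2].
  pose proof (is_series_mult _ _ _ _ Hu1 Hv1 Au1 Av1) as M11.
  pose proof (is_series_mult _ _ _ _ Hu2 Hv2 Au2 Av2) as M22.
  pose proof (is_series_mult _ _ _ _ Hu1 Hv2 Au1 Av2) as M12.
  pose proof (is_series_mult _ _ _ _ Hu2 Hv1 Au2 Av1) as M21.
  assert (F : forall (w : nat -> C) N, @sum_n C_AbelianMonoid w N =
    (sum_f_R0 (fun k => fst (w k)) N, sum_f_R0 (fun k => snd (w k)) N)).
  { intros w N. induction N; [rewrite sum_O; simpl; now destruct (w 0%nat) |].
    rewrite sum_n_C_S, IHN. reflexivity. }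
  apply Cseries_iff. split.
  - apply is_series_ext with (2 := is_series_minus _ _ _ _ M11 M22).
    intros n. unfold cauchy_product. rewrite F. cbn [fst].
    change (sum_f_R0 (fun k => fst (u k) * fst (v (n - k)%nat))%R n
      - sum_f_R0 (fun k => snd (u k) * snd (v (n - k)%nat))%R n
      = sum_f_R0 (fun k => fst (u k) * fst (v (n - k)%nat)
                         - snd (u k) * snd (v (n - k)%nat))%R n)%R.
    now rewrite <- minus_sum.
  - apply is_series_ext with (2 := is_series_plus _ _ _ _ M12 M21).
    intros n. unfold cauchy_product. rewrite F. cbn [snd].
    change (sum_f_R0 (fun k => fst (u k) * snd (v (n - k)%nat))%R n
      + sum_f_R0 (fun k => snd (u k) * fst (v (n - k)%nat))%R n
      = sum_f_R0 (fun k => fst (u k) * snd (v (n - k)%nat)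
                         + snd (u k) * fst (v (n - k)%nat))%R n)%R.
    now rewrite <- plus_sum.
Qed.

Lemma sum_n_C_ext (u v : nat -> C) (n : nat) :
  (forall k, (k <= n)%nat -> u k = v k) ->
  @sum_n C_AbelianMonoid u n = @sum_n C_AbelianMonoid v n.
Proof. apply (@sum_n_ext_loc C_AbelianMonoid). Qed.

Lemma sum_n_C_scal (c : C) (u : nat -> C) (n : nat) :
  @sum_n C_AbelianMonoid (fun k => c * u k) n = c * @sum_n C_AbelianMonoid u n.
Proof.
  induction n; [now rewrite !sum_O |]. rewrite !sum_n_C_S, IHn. symmetry. apply Cmult_plus_distr_l.
Qed.

Lemma sums_to_ext (a b : nat -> C) (f g : C -> C) :
  sums_to a f -> (forall n, a n = b n) -> (forall z, disc z -> f z = g z) -> sums_to b g.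
Proof.
  intros H Eab Efg z Hz. rewrite <- (Efg z Hz). generalize (H z Hz).
  apply Cseries_ext. intros n. now rewrite Eab.
Qed.

Lemma sums_to_mult (a b : nat -> C) (f g : C -> C) :
  sums_to a f -> sums_to b g -> sums_to (cauchy_product a b) (fun z => f z * g z).
Proof.
  intros Ha Hb z Hz.
  assert (abs : forall c h, sums_to c h -> ex_series (fun n => Cmod (c n * z ^ n))).
  { intros c h Hc. apply ex_series_ext with (fun n => Cmod (c n) * Cmod z ^ n)%R.
    - intros n. now rewrite Cmod_mult, Cmod_pow.
    - apply tame_series; [now apply sums_to_tame with h |].
      split; [apply Cmod_ge_0 | exact Hz]. }
  generalize (Cseries_mult _ _ _ _ (Ha z Hz) (Hb z Hz) (abs a f Ha) (abs b g Hb)).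
  apply Cseries_ext. intros n. unfold cauchy_product. rewrite Cmult_comm, <- sum_n_C_scal.
  apply sum_n_C_ext. intros k Hk.
  replace (z ^ n) with (z ^ k * z ^ (n - k)).
  - ring.
  - rewrite <- Cpow_add_r. f_equal. lia.
Qed.

(** The coefficients of the solution of [u' = p u], [u(0) = 1]; a table of the
    values computed so far makes the course-of-values recursion structural. *)
Fixpoint exp_table (p : nat -> C) (n : nat) : nat -> C :=
  match n with
  | O => fun _ => RtoC 1
  | S m => fun k =>
      if (k <=? m)%nat then exp_table p m k
      else cauchy_product p (exp_table p m) m / RtoC (INR (S m))
  end.

Definition exp_coef (p : nat -> C) (n : nat) : C := exp_table p n n.

Lemma exp_table_coef (p : nat -> C) (n k : nat) :
  (k <= n)%nat -> exp_table p n k = exp_coef p k.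
Proof.
  induction n as [| n IH]; intros Hk.
  - now replace k with 0%nat by lia.
  - destruct (Nat.eq_dec k (S n)) as [-> | N]; [reflexivity |].
    simpl. replace (k <=? n)%nat with true by (symmetry; apply Nat.leb_le; lia).
    apply IH. lia.
Qed.

Lemma exp_coef_S (p : nat -> C) (n : nat) :
  exp_coef p (S n) = cauchy_product p (exp_coef p) n / RtoC (INR (S n)).
Proof.
  unfold exp_coef at 1. cbn [exp_table].
  replace (S n <=? n)%nat with false by (symmetry; apply Nat.leb_gt; lia).
  f_equal. apply sum_n_C_ext. intros k Hk. rewrite exp_table_coef by lia. reflexivity.
Qed.

Lemma RtoC_INR_S_neq0 (n : nat) : RtoC (INR (S n)) <> RtoC 0.
Proof. intros E. apply RtoC_inj in E. now apply (not_0_INR (S n)). Qed.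

(** In the recursion for [(n + 1) u_{n+1}] the sum stays bounded relative to a
    bound for the earlier terms, so the factor [n + 1] wins from some index on. *)
Lemma tame_exp_coef (p : nat -> C) : tame p -> tame (exp_coef p).
Proof.
  intros Hp rho Hr. set (sig := ((1 + rho) / 2)%R).
  assert (Hsig : (0 < sig < 1 /\ rho < sig)%R) by (unfold sig; lra).
  destruct (Hp sig ltac:(lra)) as [M [HM BM]].
  set (q := (rho / sig)%R).
  assert (Hq : (0 < q < 1)%R).
  { unfold q. split; [apply Rdiv_lt_0_compat; lra |].
    apply Rmult_lt_reg_r with sig; [lra |]. field_simplify; lra. }
  (* the index from which n + 1 exceeds the geometric sum *)
  destruct (INR_unbounded (M / (1 - q))) as [N HN].
  set (u := exp_coef p).
  destruct (finite_upper_bound (fun n => Cmod (u n) * rho ^ n)%R N) as [K [HK BK]].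
  exists K. split; auto. intros n. induction n as [n IH] using (well_founded_induction Nat.lt_wf_0).
  destruct (Nat.le_gt_cases n N) as [L | L]; [now apply BK |].
  destruct n as [| n]; [lia |].
  assert (Hsum : forall m, (m <= n)%nat ->
    (Cmod (@sum_n C_AbelianMonoid (fun k => p k * u (n - k)%nat)%C m) * rho ^ n
     <= M * K * ((1 - q ^ S m) / (1 - q)))%R).
  { assert (term : forall k, (k <= n)%nat ->
      (Cmod (p k * u (n - k)%nat) * rho ^ n <= M * K * q ^ k)%R).
    { intros k Hk. rewrite Cmod_mult.
      replace (rho ^ n)%R with ((sig ^ k * q ^ k) * rho ^ (n - k))%R.
      2:{ rewrite <- Rpow_mult_distr. unfold q.
          replace (sig * (rho / sig))%R with rho by (field; lra).
          rewrite <- pow_add. f_equal. lia. }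
      replace (Cmod (p k) * Cmod (u (n - k)%nat) * (sig ^ k * q ^ k * rho ^ (n - k)))%R
        with ((Cmod (p k) * sig ^ k) * (Cmod (u (n - k)%nat) * rho ^ (n - k)) * q ^ k)%R
        by ring.
      apply Rmult_le_compat_r; [apply pow_le; lra |].
      apply Rmult_le_compat; auto.
      - apply Rmult_le_pos; [apply Cmod_ge_0 | apply pow_le; lra].
      - apply Rmult_le_pos; [apply Cmod_ge_0 | apply pow_le; lra].
      - apply IH. lia. }
    induction m as [| m IHm]; intros Hm.
    - rewrite sum_O. specialize (term 0%nat Hm).
      replace ((1 - q ^ 1) / (1 - q))%R with 1%R by (field; lra).
      simpl (q ^ 0)%R in term. exact term.
    - rewrite sum_n_C_S. specialize (IHm ltac:(lia)). specialize (term (S m) Hm).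
      replace ((1 - q ^ S (S m)) / (1 - q))%R
        with ((1 - q ^ S m) / (1 - q) + q ^ S m)%R by (simpl; field; lra).
      assert (P : (0 <= rho ^ n)%R) by (apply pow_le; lra).
      eapply Rle_trans; [apply Rmult_le_compat_r; [exact P | apply Cmod_triangle] |].
      lra. }
  specialize (Hsum n (le_n n)).
  change (Cmod (cauchy_product p u n) * rho ^ n <= M * K * ((1 - q ^ S n) / (1 - q)))%R in Hsum.
  unfold u at 1. rewrite exp_coef_S. fold u.
  rewrite Cmod_div by apply RtoC_INR_S_neq0.
  rewrite Cmod_R, Rabs_pos_eq by apply pos_INR.
  assert (Hn : (M / (1 - q) < INR (S n))%R).
  { eapply Rlt_le_trans; [apply HN | apply le_INR; lia]. }
  assert (Pn : (0 < INR (S n))%R) by (apply lt_0_INR; lia).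
  apply Rmult_le_reg_l with (INR (S n)); auto.
  replace (INR (S n) * (Cmod (cauchy_product p u n) / INR (S n) * rho ^ S n))%R
    with (rho * (Cmod (cauchy_product p u n) * rho ^ n))%R
    by (rewrite <- tech_pow_Rmult; field; lra).
  set (x := (Cmod (cauchy_product p u n) * rho ^ n)%R) in *.
  assert (x0 : (0 <= x)%R).
  { unfold x. apply Rmult_le_pos; [apply Cmod_ge_0 | apply pow_le; lra]. }
  assert (x1 : (x <= M / (1 - q) * K)%R).
  { eapply Rle_trans; [apply Hsum |].
    replace (M * K * ((1 - q ^ S n) / (1 - q)))%R
      with (M / (1 - q) * K * (1 - q ^ S n))%R by (field; lra).
    assert (0 <= q ^ S n)%R by (apply pow_le; lra).
    assert (0 <= M / (1 - q) * K)%R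
      by (apply Rmult_le_pos; auto; apply Rdiv_le_0_compat; lra).
    nra. }
  assert (M / (1 - q) * K <= INR (S n) * K)%R by (apply Rmult_le_compat_r; lra).
  assert (rho * x <= 1 * x)%R by (apply Rmult_le_compat_r; lra). lra.
Qed.

(** Both sides solve [u' = L' u], [u(0) = 1], and the quotient of two solutions has
    derivative 0. *)
Lemma Cexp_sums_to (l : nat -> C) (L : C -> C) :
  sums_to l L -> l 0%nat = RtoC 0 ->
  sums_to (exp_coef (dcoef l)) (fun z => Cexp (L z)).
Proof.
  intros HL l0. pose proof (tame_dcoef _ (sums_to_tame _ _ HL)) as Tp.
  destruct (tame_sums_to _ Tp) as [P HP].
  destruct (tame_sums_to _ (tame_exp_coef _ Tp)) as [U HU].
  set (u := exp_coef (dcoef l)) in *.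
  assert (HU' : sums_to (dcoef u) (fun z => P z * U z)).
  { apply sums_to_ext with (1 := sums_to_mult _ _ _ _ HP HU); auto.
    intros n. unfold dcoef at 2. unfold u at 2. rewrite exp_coef_S. fold u.
    field. apply RtoC_INR_S_neq0. }
  assert (dU : forall z, disc z -> deriv_at U z (P z * U z)).
  { intros z Hz. apply (sums_to_deriv_at u U (fun z => P z * U z)); auto. }
  assert (dL : forall z, disc z -> deriv_at L z (P z)).
  { intros z Hz. now apply (sums_to_deriv_at l L P). }
  assert (dQ : forall z, disc z -> deriv_at (fun z => U z * Cexp (- L z)) z (RtoC 0)).
  { intros z Hz.
    replace (RtoC 0)
      with (P z * U z * Cexp (- L z) + U z * (Cexp (- L z) * - P z)) by ring.
    apply (deriv_at_mult U (fun z => Cexp (- L z))); auto.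
    apply (deriv_at_comp Cexp (fun z => - L z) z (Cexp (- L z)) (- P z)); [apply deriv_at_Cexp |].
    apply deriv_at_opp; auto. }
  apply sums_to_ext with (1 := HU); auto. intros z Hz.
  pose proof (zero_deriv_constant _ dQ z Hz) as E. cbv beta in E.
  rewrite (sums_to_0 _ _ HU), (sums_to_0 _ _ HL), l0 in E.
  replace (- RtoC 0) with (RtoC 0) in E by ring.
  rewrite Cexp_0 in E. change (u 0%nat) with (RtoC 1) in E.
  rewrite <- (Cmult_1_r (U z)), <- (Cexp_opp_r (L z)).
  replace (U z * (Cexp (L z) * Cexp (- L z)))
    with ((U z * Cexp (- L z)) * Cexp (L z)) by ring.
  rewrite E. ring.
Qed.

Lemma exp_coef_1 (p : nat -> C) : exp_coef p 1 = p 0%nat.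
Proof.
  rewrite exp_coef_S. unfold cauchy_product. rewrite sum_O. simpl. unfold exp_coef; simpl. field.
Qed.

Lemma exp_coef_2 (p : nat -> C) : exp_coef p 2 = (p 0%nat ^ 2 + p 1%nat) / 2.
Proof.
  rewrite exp_coef_S. unfold cauchy_product. rewrite sum_n_C_S, sum_O. simpl (_ - _)%nat.
  rewrite exp_coef_1. unfold exp_coef; simpl.
  replace (RtoC (1 + 1)) with (RtoC 2) by (f_equal; ring). field.
Qed.

Lemma exp_coef_3 (p : nat -> C) :
  exp_coef p 3 = (p 0%nat ^ 3 + 3 * p 0%nat * p 1%nat + 2 * p 2%nat) / 6.
Proof.
  rewrite exp_coef_S. unfold cauchy_product. rewrite !sum_n_C_S, sum_O. simpl (_ - _)%nat.
  rewrite exp_coef_2, exp_coef_1. unfold exp_coef; simpl.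
  replace (RtoC (1 + 1 + 1)) with (RtoC 3) by (f_equal; ring). field.
Qed.

(** * Univalence *)

Lemma Cmod_Cexp (z : C) : Cmod (Cexp z) = exp (Re z).
Proof.
  assert (P : (0 < exp (Re z))%R) by apply exp_pos.
  replace (Cexp z) with (RtoC (exp (Re z)) * (cos (Im z), sin (Im z))).
  2:{ unfold Cexp, Cmult, RtoC; simpl. f_equal; ring. }
  rewrite Cmod_mult, Cmod_R, Rabs_pos_eq by lra.
  unfold Cmod at 1; simpl. rewrite !Rmult_1_r.
  pose proof (sin2_cos2 (Im z)) as S. unfold Rsqr in S.
  replace (cos (Im z) * cos (Im z) + sin (Im z) * sin (Im z))%R with 1%R by lra.
  rewrite sqrt_1. ring.
Qed.

Lemma Cexp_surjective (z : C) : z <> RtoC 0 -> exists w, Cexp w = z.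
Proof.
  intros z0. apply Cmod_gt_0 in z0. set (r := Cmod z) in *.
  destruct z as [x y].
  assert (E : (x ^ 2 + y ^ 2 = r ^ 2)%R).
  { unfold r. rewrite Cmod2_alt. reflexivity. }
  set (a := (x / r)%R). set (b := (y / r)%R).
  assert (Eab : (a ^ 2 + b ^ 2 = 1)%R).
  { unfold a, b. replace ((x / r) ^ 2 + (y / r) ^ 2)%R with ((x ^ 2 + y ^ 2) / r ^ 2)%R
      by (field; lra). rewrite E. field. lra. }
  assert (Ha : (-1 <= a <= 1)%R) by nra.
  assert (T : exists th, cos th = a /\ sin th = b).
  { assert (Ss : sin (acos a) = Rabs b).
    { rewrite sin_acos by auto. rewrite <- sqrt_Rsqr_abs. f_equal. unfold Rsqr. lra. }
    destruct (Rle_dec 0 b) as [L | L].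
    - exists (acos a). rewrite cos_acos by auto. rewrite Ss, Rabs_pos_eq; auto.
    - exists (- acos a)%R. rewrite cos_neg, sin_neg, cos_acos by auto.
      rewrite Ss, Rabs_left by lra. split; [auto | ring]. }
  destruct T as [th [T1 T2]]. exists (ln r, th). unfold Cexp; simpl.
  rewrite exp_ln, T1, T2 by auto. unfold a, b. f_equal; field; lra.
Qed.

(** A function starlike in the sense that [z f' / f = 1 + z D] has positive real
    part is univalent.  In the coordinate [log z] the function becomes
    [zeta + L (exp zeta)], whose derivative has positive real part on the left
    half-plane; that is a convex set, so the segment criterion applies. *)
Lemma starlike_univalent (L D : C -> C) :
  (forall z, disc z -> deriv_at L z (D z)) ->
  (forall z, disc z -> (0 < Re (1 + z * D z))%R) ->
  univalent_on_disc (fun z => z * Cexp (L z)).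
Proof.
  intros HL Hp z w Hz Hw E.
  destruct (Ceq_dec z (RtoC 0)) as [Z | Z].
  { subst z. rewrite Cmult_0_l in E. destruct (Ceq_dec w (RtoC 0)) as [W | W]; auto.
    exfalso. symmetry in E. revert E. apply Cmult_neq_0; auto using Cexp_neq0. }
  destruct (Ceq_dec w (RtoC 0)) as [W | W].
  { exfalso. subst w. rewrite Cmult_0_l in E. revert E.
    apply Cmult_neq_0; auto using Cexp_neq0. }
  destruct (Cexp_surjective z Z) as [a Ea]. destruct (Cexp_surjective w W) as [b Eb].
  set (Phi := fun zeta => zeta + L (Cexp zeta)).
  (* the two images in the logarithmic coordinate differ by a period of the
     exponential; translating b by that period makes them equal *)
  set (tau := Phi a - Phi b).
  assert (Etau : Cexp tau = RtoC 1).
  { unfold tau, Phi. rewrite Ea, Eb.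
    replace (a + L z - (b + L w)) with ((a + L z) + - (b + L w)) by ring.
    rewrite Cexp_plus, (Cexp_plus a), Ea, E.
    rewrite <- Eb at 1. rewrite <- (Cexp_plus b). apply Cexp_opp_r. }
  set (b' := b + tau).
  assert (Eb' : Cexp b' = w).
  { unfold b'. rewrite Cexp_plus, Etau, Eb. ring. }
  assert (EPhi : Phi a = Phi b').
  { unfold b', Phi at 2. rewrite Cexp_plus, Etau, Cmult_1_r.
    unfold tau, Phi. ring. }
  assert (half : forall c, (Re c < 0)%R -> disc (Cexp c)).
  { intros c Hc. unfold disc. rewrite Cmod_Cexp, <- exp_0. now apply exp_increasing. }
  assert (half' : forall c, disc (Cexp c) -> (Re c < 0)%R).
  { intros c Hc. unfold disc in Hc. rewrite Cmod_Cexp, <- exp_0 in Hc.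
    now apply exp_lt_inv. }
  assert (Ha : (Re a < 0)%R) by (apply half'; now rewrite Ea).
  assert (Hb : (Re b' < 0)%R) by (apply half'; now rewrite Eb').
  assert (Hseg : forall s, (0 <= s <= 1)%R -> (Re (a + RtoC s * (b' - a)) < 0)%R).
  { intros s Hs. replace (Re (a + RtoC s * (b' - a))) with ((1 - s) * Re a + s * Re b')%R.
    - destruct (Req_dec s 0) as [-> | N]; [lra |]. nra.
    - unfold Re, Cplus, Cminus, Cmult, Copp, RtoC; simpl. ring. }
  assert (Eab : a = b').
  { apply (positive_real_part_injective Phi a b' (fun s =>
      1 + D (Cexp (a + RtoC s * (b' - a))) * Cexp (a + RtoC s * (b' - a)))); auto.
    - intros s Hs. set (c := a + RtoC s * (b' - a)).
      apply (deriv_at_plus (fun zeta => zeta) (fun zeta => L (Cexp zeta)));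
        [apply deriv_at_id |].
      apply (deriv_at_comp L Cexp); [| apply deriv_at_Cexp].
      apply HL, half, Hseg; auto.
    - intros s Hs. rewrite Cmult_comm. apply Hp, half, Hseg; auto. }
  rewrite <- Ea, <- Eb', Eab. reflexivity.
Qed.

(** [exp] maps the unit disc into the right half-plane, as [1 < PI / 2]; hence the
    functions with [z f' / f] subordinate to [exp] are starlike. *)
Lemma Cexp_Re_pos (w : C) : disc w -> (0 < Re (Cexp w))%R.
Proof.
  intros Hw. unfold Cexp. simpl. apply Rmult_lt_0_compat; [apply exp_pos |].
  assert (Hi : (Rabs (Im w) <= Cmod w)%R).
  { eapply Rle_trans; [| apply Rmax_Cmod]. apply Rmax_r. }
  unfold disc in Hw. assert (Hi2 : (Rabs (Im w) < 1)%R) by lra.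
  apply Rabs_lt_between in Hi2. pose proof PI2_1. apply cos_gt_0; lra.
Qed.

(** * The extremal function *)

Lemma sums_to_cons (a : nat -> C) (g : C -> C) :
  sums_to (fun n => a (S n)) g -> sums_to a (fun z => a 0%nat + z * g z).
Proof.
  intros H z Hz. apply (@is_series_decr_1 C_AbsRing C_NormedModule).
  change (Cseries (fun n => a (S n) * z ^ S n)
    (a 0%nat + z * g z - a 0%nat * 1)).
  replace (a 0%nat + z * g z - a 0%nat * 1) with (z * g z) by ring.
  generalize (Cseries_scal z _ _ (H z Hz)). apply Cseries_ext.
  intros n. simpl. ring.
Qed.

Lemma sums_to_scal (c : C) (a : nat -> C) (f : C -> C) :
  sums_to a f -> sums_to (fun n => c * a n) (fun z => c * f z).
Proof.
  intros H z Hz. generalize (Cseries_scal c _ _ (H z Hz)). apply Cseries_ext.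
  intros n. ring.
Qed.

Lemma sums_to_geometric (c : R) : (0 <= c < 1)%R ->
  sums_to (fun n => RtoC c ^ n) (fun z => / (1 - RtoC c * z)).
Proof.
  intros Hc.
  assert (T : tame (fun n => RtoC c ^ n)).
  { intros r Hr. exists 1%R. split; [lra |]. intros n.
    rewrite Cmod_pow, Cmod_R, Rabs_pos_eq, <- Rpow_mult_distr by lra.
    rewrite <- (pow1 n). apply pow_incr. nra. }
  destruct (tame_sums_to _ T) as [g Hg].
  apply sums_to_ext with (1 := Hg); auto. intros z Hz.
  pose proof (sums_to_cons (fun n => RtoC c ^ n) _ (sums_to_scal (RtoC c) _ _ Hg)) as H.
  assert (E : g z = RtoC 1 + z * (RtoC c * g z))
    by exact (Cseries_unique _ _ _ (Hg z Hz) (H z Hz)).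
  assert (N : 1 - RtoC c * z <> RtoC 0).
  { intros Z. apply (Rlt_irrefl 1). rewrite <- Cmod_1 at 1.
    replace (RtoC 1) with (RtoC c * z + (1 - RtoC c * z)) at 1 by ring.
    rewrite Z, Cplus_0_r, Cmod_mult, Cmod_R, Rabs_pos_eq by lra.
    unfold disc in Hz. pose proof (Cmod_ge_0 z). nra. }
  assert (E1 : g z * (1 - RtoC c * z) = 1).
  { transitivity (g z - z * (RtoC c * g z)); [ring |].
    rewrite E at 1. ring. }
  transitivity (g z * (1 - RtoC c * z) * / (1 - RtoC c * z)); [field; auto |].
  rewrite E1. ring.
Qed.

(** The Blaschke product [z (c - z) / (1 - c z)]: up to rotation, equality in the
    triangle inequality forces the Schur parameter [zeta] to be [-1], and then [c] is
    the only freedom. *)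
Definition blaschke (c : R) (z : C) : C := z * ((RtoC c - z) / (1 - RtoC c * z)).

Definition blaschke_coef (c : R) (n : nat) : C :=
  match n with
  | O => RtoC 0
  | S O => RtoC c
  | S (S k) => RtoC (c ^ 2 - 1) * RtoC c ^ k
  end.

Lemma one_minus_real_mult_neq0 (c : R) (z : C) :
  (0 <= c < 1)%R -> disc z -> 1 - RtoC c * z <> RtoC 0.
Proof.
  intros Hc Hz. replace (RtoC c) with (Cconj (RtoC c)).
  - apply one_minus_conj_mult_neq0; auto. rewrite Cmod_R, Rabs_pos_eq; lra.
  - unfold Cconj, RtoC; simpl. f_equal; ring.
Qed.

Lemma blaschke_sums_to (c : R) : (0 <= c < 1)%R ->
  sums_to (blaschke_coef c) (blaschke c).
Proof.
  intros Hc.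
  pose proof (sums_to_scal (RtoC (c ^ 2 - 1)) _ _ (sums_to_geometric c Hc)) as H.
  pose proof (sums_to_cons (blaschke_coef c) _
    (sums_to_cons (fun n => blaschke_coef c (S n)) _ H)) as H2.
  apply sums_to_ext with (1 := H2); auto. intros z Hz.
  cbn [blaschke_coef]. unfold blaschke. rewrite RtoC_minus, RtoC_pow. field.
  now apply one_minus_real_mult_neq0.
Qed.

Lemma blaschke_disc (c : R) (z : C) : (0 <= c < 1)%R -> disc z -> disc (blaschke c z).
Proof.
  intros Hc Hz. unfold disc, blaschke in *.
  pose proof (one_minus_real_mult_neq0 c z Hc Hz) as N.
  pose proof (disc_automorphism_identity (RtoC c) z) as I.
  replace (Cconj (RtoC c)) with (RtoC c) in I
    by (unfold Cconj, RtoC; simpl; f_equal; ring).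
  rewrite (Cmod_sub_sym z), Cmod_R, Rabs_pos_eq in I by lra.
  rewrite Cmod_mult, Cmod_div by auto. apply Cmod_gt_0 in N.
  set (n := Cmod (1 - RtoC c * z)) in *. set (m := Cmod (RtoC c - z)) in *.
  pose proof (Cmod_ge_0 z) as Pz. pose proof (Cmod_ge_0 (RtoC c - z)) as Pm. fold m in Pm.
  assert (Hmn : (m <= n)%R).
  { apply Rsqr_incr_0_var; [| lra]. unfold Rsqr.
    assert (0 <= (1 - c ^ 2) * (1 - Cmod z ^ 2))%R by (apply Rmult_le_pos; nra). nra. }
  assert (Hq : (0 <= m / n <= 1)%R).
  { split; [apply Rdiv_le_0_compat; lra |].
    apply Rmult_le_reg_r with n; auto. field_simplify; lra. }
  nra.
Qed.

(** The solution of [z f' / f = exp omega] for the Blaschke product [omega] is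
    [f = z exp L] with [z L' = exp omega - 1]; two applications of [Cexp_sums_to]
    give its power series, and the recursions give the first coefficients. *)
Lemma extremal_function_exists (c : R) : (0 <= c < 1)%R ->
  exists f a, class_Se f /\ normalized_expansion f a /\
  (a 2%nat * a 3%nat - a 4%nat)%C = RtoC ((2 * c - 7 / 6 * c ^ 3) / 3).
Proof.
  intros Hc. set (w := blaschke_coef c).
  pose proof (blaschke_sums_to c Hc) as HW. fold w in HW.
  pose proof (Cexp_sums_to w _ HW eq_refl) as HE.
  set (e := exp_coef (dcoef w)) in *.
  assert (e0 : e 0%nat = RtoC 1) by reflexivity.
  (* L is the primitive of D = (exp omega - 1) / z *)
  destruct (sums_to_tail _ _ HE) as [D [HD ED]]. rewrite e0 in ED.
  set (l := fun n => match n with O => RtoC 0 | S k => e (S k) / RtoC (INR (S k)) end).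
  assert (El : forall n, dcoef l n = e (S n)).
  { intros n. unfold dcoef, l. field. apply RtoC_INR_S_neq0. }
  assert (Tl : tame l).
  { intros r Hr. destruct (sums_to_tame _ _ HE r Hr) as [M [HM B]].
    exists M; split; auto. intros [| n].
    - simpl. rewrite Cmod_0. lra.
    - eapply Rle_trans; [| apply (B (S n))].
      apply Rmult_le_compat_r; [apply pow_le; lra |].
      unfold l. rewrite Cmod_div by apply RtoC_INR_S_neq0.
      rewrite Cmod_R, Rabs_pos_eq by apply pos_INR.
      assert (1 <= INR (S n))%R by (rewrite S_INR; pose proof (pos_INR n); lra).
      pose proof (Cmod_ge_0 (e (S n))).
      apply Rmult_le_reg_r with (INR (S n)); [lra |]. unfold Rdiv.
      rewrite Rmult_assoc, Rinv_l, Rmult_1_r by lra. nra. }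
  destruct (tame_sums_to _ Tl) as [L HL].
  assert (HD' : sums_to (dcoef l) D).
  { apply sums_to_ext with (1 := HD); auto. }
  assert (dL : forall z, disc z -> deriv_at L z (D z)).
  { intros z Hz. now apply (sums_to_deriv_at l L D). }
  pose proof (Cexp_sums_to l _ HL eq_refl) as HU.
  set (u := exp_coef (dcoef l)) in *.
  set (f := fun z => z * Cexp (L z)).
  set (a := fun n => match n with O => RtoC 0 | S k => u k end).
  assert (Ha : sums_to a f).
  { pose proof (sums_to_cons a _ HU) as H. apply sums_to_ext with (1 := H); auto.
    intros z _. unfold f. simpl. ring. }
  assert (df : forall z, disc z ->
            deriv_at f z (Cexp (blaschke c z) * Cexp (L z))).
  { intros z Hz. rewrite ED by auto.
    replace ((1 + z * D z) * Cexp (L z))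
      with (1 * Cexp (L z) + z * (Cexp (L z) * D z)) by ring.
    apply (deriv_at_mult (fun z => z) (fun z => Cexp (L z))); [apply deriv_at_id |].
    apply (deriv_at_comp Cexp L); auto using deriv_at_Cexp. }
  assert (dC : forall z, disc z -> C_derive f z = Cexp (blaschke c z) * Cexp (L z)).
  { intros z Hz. apply is_C_derive_unique, deriv_at_is_derive. auto. }
  assert (L0 : L (RtoC 0) = RtoC 0) by (now rewrite (sums_to_0 _ _ HL)).
  assert (B0 : blaschke c (RtoC 0) = RtoC 0) by (unfold blaschke; ring).
  exists f, a. split; [split | split].
  - split; [| split; [| split]].
    + intros z Hz. eexists. apply deriv_at_is_derive. auto.
    + apply (starlike_univalent L D); auto. intros z Hz. rewrite <- ED by auto.
      apply Cexp_Re_pos, blaschke_disc; auto.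
    + unfold f. ring.
    + rewrite dC by apply disc_0. rewrite B0, L0, Cexp_0. ring.
  - exists (blaschke c). split; [| split; [| split]].
    + intros z Hz. destruct (smooth2_deriv_at _ _ (sums_to_smooth2 _ _ _ HW Hz)) as [p Hp].
      exists p. now apply deriv_at_is_derive.
    + intros z Hz. now apply blaschke_disc.
    + exact B0.
    + intros z Hz. unfold log_quotient.
      destruct (Ceq_dec z (RtoC 0)) as [-> | N].
      * now rewrite B0, Cexp_0.
      * rewrite dC by auto. unfold f. field. split; auto using Cexp_neq0.
  - split; [reflexivity | split; [reflexivity |]].
    apply sums_to_pseries. exact Ha.
  - change (u 1%nat * u 2%nat - u 3%nat = RtoC ((2 * c - 7 / 6 * c ^ 3) / 3)).
    unfold u. rewrite exp_coef_1, exp_coef_2, exp_coef_3, !El.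
    unfold e. rewrite exp_coef_1, exp_coef_2, exp_coef_3.
    unfold dcoef, w, blaschke_coef. simpl INR. simpl (RtoC c ^ _).
    rewrite ?RtoC_div, ?RtoC_minus, ?RtoC_mult, ?RtoC_plus, ?RtoC_pow by lra.
    rewrite ?RtoC_div by lra. field.
Qed.

Local Close Scope C_scope.

Theorem theorem5p1 :
  (forall (f : C -> C) (a : nat -> C),
     class_Se f -> normalized_expansion f a ->
     Cmod (a 2%nat * a 3%nat - a 4%nat)%C <= 8 / (9 * sqrt 7)) /\
  (exists (f : C -> C) (a : nat -> C),
     class_Se f /\ normalized_expansion f a /\
     Cmod (a 2%nat * a 3%nat - a 4%nat)%C = 8 / (9 * sqrt 7)).
Proof.
  split; [exact class_Se_bound |].
  pose proof (sqrt_lt_R0 7 ltac:(lra)) as S0. pose proof (sqrt_sqrt 7 ltac:(lra)) as SS.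
  (* the point at which two_variable_maximum is attained *)
  set (c := (2 / sqrt 7)%R).
  assert (c0 : (0 < c)%R) by (unfold c; apply Rdiv_lt_0_compat; lra).
  assert (c2 : (c ^ 2 = 4 / 7)%R).
  { unfold c. replace ((2 / sqrt 7) ^ 2)%R with (4 / (sqrt 7 * sqrt 7))%R by (field; lra).
    rewrite SS. reflexivity. }
  assert (Hc : (0 <= c < 1)%R) by nra.
  destruct (extremal_function_exists c Hc) as [f [a [Hf [Ha E]]]].
  exists f, a. split; [auto | split; [auto |]].
  rewrite E, Cmod_R.
  replace ((2 * c - 7 / 6 * c ^ 3) / 3)%R with ((2 * c - 7 / 6 * c * c ^ 2) / 3)%R by field.
  rewrite c2.
  replace ((2 * c - 7 / 6 * c * (4 / 7)) / 3)%R with (4 / 9 * c)%R by field.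
  rewrite Rabs_pos_eq by lra. unfold c. field. lra.
Qed.
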